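(* For Bernoulli rewards, let BDQ-KL be the algorithm that replaces the residual rule of BDQ-UCB by kl-UCB$^{++}$, run on residual observations only with horizon parameter $R$. BDQ-KL retains the deterministic blockwise fairness guarantee ($N_{b,i}\ge m_{b,i}$ for every block $b$ and arm $i$), its expected fair regret is at most $C\sqrt{KR}+K$ for a universal constant $C$, and on every fixed instance (fixed $K$ and fixed means $\mu$) $$\limsup_{R\to\infty}\frac{\mathrm{Reg}_{\mathbf m}(T)}{\log R}\ \le\ \sum_{i\ne i^\star}\frac{\Delta_i}{\mathrm{kl}(\mu_i,\mu_\star)},$$ where terms with $\Delta_i=0$ are read as $0$.
   Context: Bandit: arm $i\in[K]$ produces independent Bernoulli rewards with mean $\mu_i$; $\mu_\star=\max_i\mu_i$, $i^\star$ a best arm, $\Delta_i=\mu_\star-\mu_i$; $A_t$ is the arm pulled at round $t$; $\mathrm{kl}(p,q)=p\log\frac pq+(1-p)\log\frac{1-p}{1-q}$. Blockwise floors: the horizon $T=\sum_{b=1}^BH_b$ is partitioned into consecutive blocks, block $b$ of length $H_b$ with floor vector $m_b\in\mathbb Z_{\ge0}^K$, $\sum_im_{b,i}\le H_b$; $N_{b,i}$ is the number of pulls of arm $i$ in block $b$; $R=\sum_b(H_b-\sum_im_{b,i})$. $\mathrm{OPT}_{\mathbf m}(T)=T\mu_\star-\sum_b\sum_{i\ne i^\star}m_{b,i}\Delta_i$, $\mathrm{Reg}_{\mathbf m}(T)=\mathrm{OPT}_{\mathbf m}(T)-\mathbb E[\sum_t\mu_{A_t}]$. BDQ-KL: in each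 block $b$ first pull each arm $i$ exactly $m_{b,i}$ times (mandatory); in the remaining (residual) rounds use the following rule based only on residual observations. With $N_i^{\mathrm{res}},\widehat\mu_i^{\mathrm{res}}$ the pull count and empirical mean of arm $i$ over residual rounds alone, pull each arm once in the first $K$ residual rounds, then pull an arm maximizing the kl-UCB$^{++}$ index $$\sup\bigl\{q\in[0,1]:\ \widehat\mu_i^{\mathrm{res}}\le q,\ N_i^{\mathrm{res}}\,\mathrm{kl}(\widehat\mu_i^{\mathrm{res}},q)\le g(N_i^{\mathrm{res}})\bigr\},\quad g(n)=\log_+\!\Bigl(\tfrac{R}{Kn}\bigl(\log_+^2\bigl(\tfrac{R}{Kn}\bigr)+1\bigr)\Bigr),$$ with $\log_+(x)=\max(\log x,0)$. *)

(* Defs.v *)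
From HB Require Import structures.
From mathcomp Require Export all_boot all_order all_algebra.
From mathcomp Require Export all_classical all_reals all_analysis.
Export Order.TTheory GRing.Theory Num.Theory.
Export numFieldNormedType.Exports.

Set Implicit Arguments.
Unset Strict Implicit.
Unset Printing Implicit Defensive.

Local Open Scope classical_set_scope.
Local Open Scope ring_scope.

(* [kl] is extended-real valued, with the usual conventions
   0 log (0 / y) = 0 and x log (x / 0) = +oo for x > 0
   ([ln] itself is 0 on nonpositive arguments). *)
Definition kl_term (R : realType) (x y : R) : \bar R :=
  if x == 0 then 0%E else if y == 0 then +oo%E else (x * ln (x / y))%:E.

Definition kl (R : realType) (p q : R) : \bar R :=
  (kl_term p q + kl_term (1 - p) (1 - q))%E.

(* [ln 0 = 0], so [logp 0 = 0] agrees with max (-oo, 0). *)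
Definition logp (R : realType) (x : R) : R := Num.max (ln x) 0.

Definition mustar (R : realType) (K : nat) (mu : 'I_K -> R) : R :=
  \big[Num.max/0]_(i < K) mu i.

Definition Delta (R : realType) (K : nat) (mu : 'I_K -> R) (i : 'I_K) : R :=
  mustar mu - mu i.

Definition mutually_independent d d' (Omega : measurableType d)
    (T : measurableType d') (R : realType) (P : probability Omega R)
    (I : eqType) (X : I -> {RV P >-> T}) : Prop :=
  forall (J : seq I) (B : I -> set T), uniq J -> (forall j, measurable (B j)) ->
    P (\bigcap_(j in [set` J]) (X j @^-1` B j)) =
      (\prod_(j <- J) P (X j @^-1` B j))%E.

(* [Y t i] is the reward that arm [i] yields if it is pulled at round [t]. *)
Definition bernoulli_rewards d (Omega : measurableType d) (R : realType)
    (P : probability Omega R) (K : nat) (mu : 'I_K -> R)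
    (Y : nat -> 'I_K -> {RV P >-> bool}) : Prop :=
  (forall t i, distribution P (Y t i) =1 bernoulli_prob (mu i)) /\
  mutually_independent (fun ti : nat * 'I_K => Y ti.1 ti.2).

Record floors (K : nat) := Floors {
  nblocks : nat;
  blen : 'I_nblocks -> nat;
  mfloor : 'I_nblocks -> 'I_K -> nat;
  mfloor_le : forall b, (\sum_(i < K) mfloor b i <= blen b)%N }.

Definition horizon (K : nat) (m : floors K) : nat :=
  (\sum_(b < nblocks m) blen b)%N.

Definition residual (K : nat) (m : floors K) : nat :=
  (\sum_(b < nblocks m) (blen b - \sum_(i < K) mfloor b i))%N.

(* A history lists the (arm, reward) pairs observed so far, oldest first. *)
Definition history (K : nat) := seq ('I_K * bool).

Definition npulls (K : nat) (h : history K) (i : 'I_K) : nat :=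
  count (fun x => x.1 == i) h.

Definition emp_mean (R : realType) (K : nat) (h : history K) (i : 'I_K) : R :=
  (count_mem (i, true) h)%:R / (npulls h i)%:R.

Definition explo (R : realType) (K Rh n : nat) : R :=
  let x := Rh%:R / (K%:R * n%:R) in logp (x * (logp x ^+ 2 + 1)).

(* [Rh] is the horizon parameter. *)
Definition klucbpp_index (R : realType) (K Rh : nat) (h : history K)
    (i : 'I_K) : R :=
  sup [set q : R | [/\ 0 <= q <= 1, emp_mean R h i <= q &
    ((npulls h i)%:R%:E * kl (emp_mean R h i) q
      <= (explo R K Rh (npulls h i))%:E)%E]].

(* The order of the first [K] pulls and the choice among maximizers are left
   to [rule]. *)
Definition is_klucbpp (R : realType) (K Rh : nat)
    (rule : history K -> 'I_K) : Prop :=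
  forall h : history K,
    if (size h < K)%N then npulls h (rule h) = 0%N
    else forall j, klucbpp_index R Rh h j <= klucbpp_index R Rh h (rule h).

(* What BDQ-KL leaves unspecified: the order of the mandatory pulls of each
   block and the remaining choices of the residual rule, which is applied to the
   residual history only. *)
Record bdq_kl (R : realType) (K : nat) (m : floors K) := BdqKl {
  mandatory : 'I_(nblocks m) -> seq 'I_K;
  rule : history K -> 'I_K;
  mandatory_count : forall b i, count_mem i (mandatory b) = mfloor b i;
  rule_klucbpp : is_klucbpp R (residual m) rule }.

(* The sequence of rounds, each tagged with its block: [Some i] is a mandatory
   pull of [i] and [None] is a residual round. *)
Definition rounds (R : realType) (K : nat) (m : floors K) (alg : bdq_kl R m) :
    seq ('I_(nblocks m) * option 'I_K) :=
  flatten [seq [seq (b, o) | o <- map Some (mandatory alg b) ++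
                   nseq (blen b - \sum_(i < K) mfloor b i) None]
          | b <- enum 'I_(nblocks m)].

(* Plays the rounds [s] from round [t] on, after the residual history [h],
   against the reward table [y]; returns the (block, arm) pairs. *)
Fixpoint play (B K : nat) (rule : history K -> 'I_K) (y : nat -> 'I_K -> bool)
    (t : nat) (h : history K) (s : seq ('I_B * option 'I_K)) :
    seq ('I_B * 'I_K) :=
  match s with
  | [::] => [::]
  | (b, Some i) :: s' => (b, i) :: play rule y t.+1 h s'
  | (b, None) :: s' =>
      let a := rule h in (b, a) :: play rule y t.+1 (rcons h (a, y t a)) s'
  end.

Definition trajectory (R : realType) (K : nat) (m : floors K)
    (alg : bdq_kl R m) (y : nat -> 'I_K -> bool) : seq ('I_(nblocks m) * 'I_K) :=
  play (rule alg) y 0 [::] (rounds alg).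

Definition block_pulls (R : realType) (K : nat) (m : floors K)
    (alg : bdq_kl R m) (y : nat -> 'I_K -> bool) (b : 'I_(nblocks m))
    (i : 'I_K) : nat :=
  count_mem (b, i) (trajectory alg y).

Definition OPT (R : realType) (K : nat) (mu : 'I_K -> R) (istar : 'I_K)
    (m : floors K) : R :=
  (horizon m)%:R * mustar mu
  - \sum_(b < nblocks m) \sum_(i < K | i != istar)
      (mfloor b i)%:R * Delta mu i.

Definition Reg d (Omega : measurableType d) (R : realType)
    (P : probability Omega R) (K : nat) (mu : 'I_K -> R) (istar : 'I_K)
    (Y : nat -> 'I_K -> {RV P >-> bool}) (m : floors K) (alg : bdq_kl R m) :
    \bar R :=
  ((OPT mu istar m)%:E -
   'E_P[(fun w => \sum_(ba <- trajectory alg (fun t i => Y t i w)) mu ba.2)%R])%E.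

(* Main.v *)
(** Only the residual rounds matter: the mandatory pulls cancel against OPT, so
    the fair regret is the regret of kl-UCB++ over R residual rounds.  By
    independence its law is that of a finite decision tree, on which expectations
    are finite recursions ([Ex]).

    Deviations of one arm are controlled by Ville's inequality for the likelihood
    ratio of Bernoulli(z) against Bernoulli(p) ([Ex_hits]), where z is the extreme
    empirical mean in the event considered.
    Peeling the number of pulls dyadically, and each dyadic scale into about
    g(n) arithmetic slices, bounds by O(K / (R u^2)) the probability that the
    index of the best arm ever falls below mu* - u ([prhits_low_index]).

    That single tail bound yields both regret bounds.  Integrating it over
    dyadic u gives E[max (mu* - index)] = O(sqrt (K / R)), hence the minimax
    bound.  For a fixed u, multiplying it by R gives O(1) rounds with a low best
    index; apart from these and from O(1) overestimations of mu_i, a suboptimal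
    arm i is pulled at most about log R / kl(mu_i, mu* ) times. *)

Require Import Defs.
From mathcomp Require Import measurable_realfun.
From mathcomp Require Import ring lra zify.

Set Implicit Arguments.
Unset Strict Implicit.
Unset Printing Implicit Defensive.

Local Open Scope classical_set_scope.
Local Open Scope ring_scope.

(** * Binary relative entropy *)

(** Ville's inequality covers all pull counts at once, but against one fixed threshold, while the
    event that the index is low has a threshold g(n) / n that moves with n. Freezing it on a whole
    dyadic scale can lose half of the exponent, e^(-g/2) instead of e^(-g), which is too weak for a
    bound of order K / (R u^2). Between slices of ratio about 1 + 1/g only a factor e is lost, at
    the price of a union over g + 1 slices. The term log^2 + 1 inside g pays for it: with x = R / (K
    n), (g + 1) e^(-g) is at most 3 / x. What remains on the scale N is of order (N K / R) e^(-N u^2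
    / 2), and its sum over dyadic N is of order K / (R u^2). Means equal to 0 or 1 are allowed,
    whereas likelihood ratios need a reference mean strictly inside the unit interval. References
    are therefore moved off the true mean by a fraction of the deviation, which costs only
    constants. *)

Definition klr (R : realType) (p q : R) : R :=
  p * ln (p / q) + (1 - p) * ln ((1 - p) / (1 - q)).

Lemma ln_leB1 (R : realType) (x : R) : 0 < x -> ln x <= x - 1.
Proof.
move=> x0; have := @le_ln1Dx R (x - 1).
by rewrite [1 + _]addrC subrK; apply; lra.
Qed.

(** For [p] equal to 0 or 1 the zero factor yields the convention 0 log 0 = 0. At [q] equal to 0 or
    1 the real-valued [klr] would miss the value +oo, hence the care below to keep second arguments
    inside the interval. *)
Lemma kl_klr (R : realType) (p q : R) : 0 < q < 1 ->
  kl p q = (klr p q)%:E.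
Proof.
move=> /andP[q0 q1]; rewrite /kl /kl_term /klr.
have -> : (q == 0) = false by apply/eqP; lra.
have -> : (1 - q == 0) = false by apply/eqP; lra.
by case: eqP => [->|_]; case: eqP => [->|_]; rewrite ?mul0r.
Qed.

(** Write ln (x / y) as -2 ln (sqrt y / sqrt x) and apply ln t <= t - 1. Added over the two
    outcomes, the left sides give the squared Hellinger distance. *)
Lemma kl_term_ge_hellinger (R : realType) (x y : R) : 0 <= x -> 0 < y ->
  2 * (x - Num.sqrt x * Num.sqrt y) <= x * ln (x / y).
Proof.
rewrite le_eqVlt => /predU1P[<-|x0] y0; first by rewrite sqrtr0 !mul0r subr0 mulr0.
set a := Num.sqrt x; set b := Num.sqrt y.
have a0 : 0 < a by rewrite sqrtr_gt0.
have b0 : 0 < b by rewrite sqrtr_gt0.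
have xE : x = a ^+ 2 by rewrite sqr_sqrtr ?ltW.
have yE : y = b ^+ 2 by rewrite sqr_sqrtr ?ltW.
have -> : x / y = (a / b) ^+ 2 by rewrite xE yE expr_div_n.
rewrite lnXn ?divr_gt0 //.
have : ln (b / a) <= b / a - 1 by apply: ln_leB1; rewrite divr_gt0.
rewrite !ln_div ?posrE // => h.
have : x * (ln b - ln a) <= x * (b / a - 1) by rewrite ler_pM2l.
have -> : x * (b / a - 1) = a * b - x by rewrite xE; field; lra.
by rewrite -mulr_natr; lra.
Qed.

(* Hellinger distance instead of Pinsker: the constant is worse, the proof needs
   no calculus. *)
Lemma klr_ge_sqr (R : realType) (p q : R) : 0 <= p <= 1 -> 0 < q < 1 ->
  (p - q) ^+ 2 / 2 <= klr p q.
Proof.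
move=> /andP[p0 p1] /andP[q0 q1].
have h1 := kl_term_ge_hellinger p0 q0.
have h2 : 2 * (1 - p - Num.sqrt (1 - p) * Num.sqrt (1 - q))
    <= (1 - p) * ln ((1 - p) / (1 - q)) by apply: kl_term_ge_hellinger; lra.
have half (x y : R) : 0 <= x <= 1 -> 0 <= y <= 1 ->
    (x - y) ^+ 2 / 4 <= x + y - 2 * (Num.sqrt x * Num.sqrt y).
  move=> /andP[x0 x1] /andP[y0 y1].
  have := sqr_sqrtr x0; have := sqr_sqrtr y0.
  have := sqrtr_ge0 x; have := sqrtr_ge0 y.
  set a := Num.sqrt x; set b := Num.sqrt y => b0 a0 bE aE.
  have a1 : a <= 1 by rewrite -sqrtr1 ler_sqrt.
  have b1 : b <= 1 by rewrite -sqrtr1 ler_sqrt.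
  have -> : (x - y) ^+ 2 = (a - b) ^+ 2 * (a + b) ^+ 2 by rewrite -aE -bE; ring.
  have -> : x + y - 2 * (a * b) = (a - b) ^+ 2 by rewrite -aE -bE; ring.
  rewrite -mulrA ler_piMr ?sqr_ge0 // ler_pdivrMr // mul1r.
  have : (a + b) * (a + b) <= 2 * 2 by apply: ler_pM; lra.
  lra.
have h3 : (p - q) ^+ 2 / 4 <= p + q - 2 * (Num.sqrt p * Num.sqrt q).
  by apply: half; lra.
have h4 : (1 - p - (1 - q)) ^+ 2 / 4
    <= 1 - p + (1 - q) - 2 * (Num.sqrt (1 - p) * Num.sqrt (1 - q)).
  by apply: half; lra.
have -> : (p - q) ^+ 2 / 2 = (p - q) ^+ 2 / 4 + (1 - p - (1 - q)) ^+ 2 / 4 by field.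
by rewrite /klr; lra.
Qed.

Lemma klr_ge0 (R : realType) (p q : R) : 0 <= p <= 1 -> 0 < q < 1 -> 0 <= klr p q.
Proof.
by move=> hp hq; apply: le_trans (klr_ge_sqr hp hq); rewrite divr_ge0 ?sqr_ge0.
Qed.

(** Slope, in the empirical mean, of the log-likelihood ratio per observation of Bernoulli(z)
    against Bernoulli(p). *)
Definition logodds (R : realType) (z p : R) : R :=
  ln (z / p) - ln ((1 - z) / (1 - p)).

Lemma logodds_sign (R : realType) (z p : R) : 0 < z < 1 -> 0 < p < 1 -> z <= p ->
  logodds z p <= 0.
Proof.
move=> /andP[z0 z1] /andP[p0 p1] zp; rewrite /logodds subr_le0.
rewrite ler_ln ?posrE ?divr_gt0 ?subr_gt0 //.
rewrite ler_pdivrMr // mulrAC ler_pdivlMr ?subr_gt0 //; nra.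
Qed.

Lemma xlnx_div (R : realType) (x y : R) : 0 <= x -> 0 < y ->
  x * ln (x / y) = x * ln x - x * ln y.
Proof.
rewrite le_eqVlt => /predU1P[<-|x0] y0; first by rewrite !mul0r subr0.
by rewrite ln_div ?posrE // mulrBr.
Qed.

(** The Bregman identity of relative entropy. It replaces derivatives: the sign of the cross term,
    known from [logodds_sign], gives both monotonicity lemmas that follow. *)
Lemma klr_three_point (R : realType) (x z p : R) :
  0 <= x <= 1 -> 0 < z < 1 -> 0 < p < 1 ->
  klr x p = klr z p + (x - z) * logodds z p + klr x z.
Proof.
move=> /andP[x0 x1] /andP[z0 z1] /andP[p0 p1].
rewrite /klr /logodds !xlnx_div ?subr_ge0 ?subr_gt0 // ?ltW //.
rewrite !ln_div ?posrE ?subr_gt0 //; ring.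
Qed.

(** In the three-point identity at [q1] the cross term is a product of two nonpositive factors. The
    quadratic surplus is essential: it becomes the gain per observation that makes the tail bound on
    low indices summable. *)
Lemma klr_incr_r (R : realType) (x q1 q2 : R) :
  0 <= x -> x <= q1 -> q1 <= q2 -> 0 < q1 -> q2 < 1 ->
  klr x q1 + (q2 - q1) ^+ 2 / 2 <= klr x q2.
Proof.
move=> x0 xq1 q12 q10 q21.
rewrite (@klr_three_point _ x q1 q2); try lra.
have := @klr_ge_sqr R q1 q2.
have := @logodds_sign R q1 q2.
move=> /(_ _ _ q12) h1 /(_ _ _) h2.
have {}h1 : logodds q1 q2 <= 0 by apply: h1; lra.
have {}h2 : (q1 - q2) ^+ 2 / 2 <= klr q1 q2 by apply: h2; lra.
have h3 : 0 <= (x - q1) * logodds q1 q2 by apply: mulr_le0; lra.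
have -> : (q2 - q1) ^+ 2 = (q1 - q2) ^+ 2 by ring.
lra.
Qed.

Lemma klr_decr_l (R : realType) (x a b : R) :
  0 <= x -> x <= a -> a <= b -> 0 < a -> b < 1 -> klr a b <= klr x b.
Proof.
move=> x0 xa ab a0 b1; rewrite (@klr_three_point _ x a b); try lra.
have h1 : logodds a b <= 0 by apply: logodds_sign; lra.
have h2 : 0 <= klr x a by apply: klr_ge0; lra.
have h3 : 0 <= (x - a) * logodds a b by apply: mulr_le0; lra.
lra.
Qed.

(** * Adaptive sampling trees and Ville's inequality *)

Definition rewards (K : nat) (h : history K) (i : 'I_K) : seq bool :=
  [seq x.2 | x <- h & x.1 == i].

Lemma rewards_rcons (K : nat) (h : history K) x i :
  rewards (rcons h x) i = if x.1 == i then rcons (rewards h i) x.2 else rewards h i.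
Proof. by rewrite /rewards filter_rcons; case: ifP; rewrite // map_rcons. Qed.

(** The prefixes of an arm's final rewards are what was known about it at earlier times, so an event
    happening at some time becomes a function of the final history. The empty prefix counts. *)
Definition hits (B : pred (seq bool)) (r : seq bool) : bool :=
  has (fun k => B (take k r)) (iota 0 (size r).+1).

Lemma hitsP (B : pred (seq bool)) (r : seq bool) :
  reflect (exists2 k, (k <= size r)%N & B (take k r)) (hits B r).
Proof.
apply: (iffP hasP) => [[k]|[k kr Bk]].
  by rewrite mem_iota add0n ltnS; exists k.
by exists k; rewrite // mem_iota add0n ltnS.
Qed.

Lemma hits_rcons (B : pred (seq bool)) r x :
  hits B (rcons r x) = hits B r || B (rcons r x).
Proof.
rewrite /hits size_rcons -[in LHS]addn1 iotaD has_cat [X in _ || X]/= add0n orbF.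
congr (_ || _); last by rewrite -(size_rcons r x) take_size.
apply: eq_in_has => k; rewrite mem_iota add0n ltnS => kr.
by rewrite -cats1 takel_cat.
Qed.

Section Tree.
Context (R : realType) (K : nat) (mu : 'I_K -> R) (rule : history K -> 'I_K).
Context (mu01 : forall i, 0 <= mu i <= 1).

Fixpoint Ex (n : nat) (F : history K -> R) (h : history K) : R :=
  if n is n'.+1 then
    mu (rule h) * Ex n' F (rcons h (rule h, true)) +
    (1 - mu (rule h)) * Ex n' F (rcons h (rule h, false))
  else F h.

(** Pathwise regret bounds hold only for histories that the rule can produce; [Ex_le] restricts the
    comparison to these. *)
Definition consistent (h : history K) : Prop :=
  forall h1 x h2, h = rcons h1 x ++ h2 -> x.1 = rule h1.

Lemma consistent_nil : consistent [::].
Proof. by move=> h1 x h2 /(congr1 size); rewrite size_cat size_rcons. Qed.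

Lemma consistent_rcons h b : consistent h -> consistent (rcons h (rule h, b)).
Proof.
move=> ch h1 x h2; case: (lastP h2) => [|h3 y].
  by rewrite cats0 => /rcons_inj[-> <-].
by rewrite -rcons_cat => /rcons_inj[hE _]; exact: ch hE.
Qed.

Lemma consistent_rconsE h x : consistent (rcons h x) -> consistent h /\ x.1 = rule h.
Proof.
move=> ch; split=> [h1 y h2 hE|]; last by apply: (ch h x [::]); rewrite cats0.
by apply: (ch h1 y (rcons h2 x)); rewrite hE rcons_cat.
Qed.

Lemma consistent_take h k : consistent h -> consistent (take k h).
Proof.
by move=> ch h1 x h2 hE; apply: (ch h1 x (h2 ++ drop k h)); rewrite catA -hE cat_take_drop.
Qed.

Lemma Ex_le n F G h : consistent h ->
  (forall h', consistent h' -> size h' = (size h + n)%N -> F h' <= G h') ->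
  Ex n F h <= Ex n G h.
Proof.
elim: n h => [|n IH] h ch FG /=; first by apply: FG; rewrite ?addn0.
have /andP[m0 m1] := mu01 (rule h).
by apply: lerD; apply: ler_wpM2l; rewrite ?subr_ge0 //; apply: IH;
  try exact: consistent_rcons; move=> h' ch' sh'; apply: FG => //;
  rewrite sh' size_rcons addSnnS.
Qed.

Lemma ExD n F G h : Ex n (fun h => F h + G h) h = Ex n F h + Ex n G h.
Proof. by elim: n h => //= n IH h; rewrite !IH; ring. Qed.

Lemma ExZ n c F h : Ex n (fun h => c * F h) h = c * Ex n F h.
Proof. by elim: n h => //= n IH h; rewrite !IH; ring. Qed.

Lemma Ex_cst n c h : Ex n (fun=> c) h = c.
Proof. by elim: n h => //= n IH h; rewrite !IH; ring. Qed.

Lemma Ex_sum n (I : Type) (s : seq I) (P : pred I) (F : I -> history K -> R) h :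
  Ex n (fun h => \sum_(j <- s | P j) F j h) h = \sum_(j <- s | P j) Ex n (F j) h.
Proof.
elim: n h => //= n IH h; rewrite !IH !mulr_sumr -big_split /=.
by apply: eq_bigr.
Qed.

(** [L] of the rewards of arm [i] is a supermartingale under any rule, since it does not move when
    another arm is pulled. The induction starts from a node without a hit; at the first hit the
    probability, at most 1, is below [L]. *)
Lemma Ex_hits n i (L : seq bool -> R) (B : pred (seq bool)) :
  (forall r, 0 <= L r) ->
  (forall r, mu i * L (rcons r true) + (1 - mu i) * L (rcons r false) <= L r) ->
  (forall r, B r -> 1 <= L r) ->
  Ex n (fun h => (hits B (rewards h i))%:R) [::] <= L [::].
Proof.
move=> L0 Lsup BL.
have ind_le1 m h : consistent h -> Ex m (fun h => (hits B (rewards h i))%:R) h <= 1.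
  by move=> ch; rewrite -[leRHS](Ex_cst m 1 h); apply: Ex_le => // h' _ _; case: hits.
suff H m h : consistent h -> ~~ hits B (rewards h i) ->
    Ex m (fun h => (hits B (rewards h i))%:R) h <= L (rewards h i).
  case: (boolP (hits B [::])) => [|nB]; last by apply: H => //; exact: consistent_nil.
  by rewrite /hits /= orbF => /BL; apply: le_trans; apply: ind_le1; exact: consistent_nil.
elim: m h => [|m IH] h ch nB /=; first by rewrite (negbTE nB).
have /andP[m0 m1] := mu01 (rule h).
have step b : Ex m (fun h => (hits B (rewards h i))%:R) (rcons h (rule h, b))
    <= L (rewards (rcons h (rule h, b)) i).
  case: (boolP (hits B (rewards (rcons h (rule h, b)) i))) => [|nB'].
    rewrite rewards_rcons /=; case: eqP => [_|]; last by rewrite (negbTE nB).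
    rewrite hits_rcons (negbTE nB) /= => /BL; apply: le_trans.
    by apply: ind_le1; exact: consistent_rcons.
  by apply: IH => //; exact: consistent_rcons.
apply: (@le_trans _ _ (mu (rule h) * L (rewards (rcons h (rule h, true)) i) +
    (1 - mu (rule h)) * L (rewards (rcons h (rule h, false)) i))).
  by apply: lerD; apply: ler_wpM2l; rewrite ?subr_ge0.
rewrite !rewards_rcons /=; case: eqP => [->|_]; first exact: Lsup.
by rewrite -mulrDl addrC subrK mul1r.
Qed.

Definition prhits n i (B : pred (seq bool)) : R :=
  Ex n (fun h => (hits B (rewards h i))%:R) [::].

(** The prefix that hits [B] itself hits some [C j]. Covering is required only up to length [n], the
    number of rounds; this bound later makes the set of possible empirical means finite. *)
Lemma prhits_le_sum n i (B : pred (seq bool)) (I : eqType) (s : seq I) (C : I -> pred (seq bool)) :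
  (forall r, (size r <= n)%N -> B r -> has (fun j => C j r) s) ->
  prhits n i B <= \sum_(j <- s) prhits n i (C j).
Proof.
move=> BC; rewrite -Ex_sum; apply: Ex_le; first exact: consistent_nil.
move=> h _; rewrite add0n => sh.
have [/hitsP[k kr Bk]|_] := boolP (hits B _); last by rewrite sumr_ge0.
have kn : (size (take k (rewards h i)) <= n)%N.
  by rewrite size_takel // -sh (leq_trans kr) // size_map size_filter count_size.
have /hasP[j js Cj] := BC _ kn Bk.
rewrite (big_rem j js) /=.
have -> : hits (C j) (rewards h i) by apply/hitsP; exists k.
by rewrite lerDl sumr_ge0.
Qed.

Lemma prhits_le n i (B C : pred (seq bool)) :
  (forall r, (size r <= n)%N -> B r -> C r) -> prhits n i B <= prhits n i C.
Proof.
move=> BC; rewrite -[leRHS](big_seq1 +%R tt (fun=> prhits n i C)).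
by apply: prhits_le_sum => r rn /= /BC ->.
Qed.

Lemma prhits_ge0 n i B : 0 <= prhits n i B.
Proof.
rewrite -[leLHS](Ex_cst n 0 [::]); apply: Ex_le; first exact: consistent_nil.
by move=> h _ _; rewrite ler0n.
Qed.

Lemma prhits0 n i (B : pred (seq bool)) : (forall r, (size r <= n)%N -> ~~ B r) -> prhits n i B = 0.
Proof.
move=> B0; apply/eqP; rewrite eq_le prhits_ge0 andbT.
have := @prhits_le_sum n i B nat [::] (fun=> xpredT).
by rewrite big_nil; apply=> r /B0 /negbTE ->.
Qed.

End Tree.

(** * Likelihood ratios of Bernoulli samples *)

Definition ones (r : seq bool) : nat := count id r.

Definition smean (R : realType) (r : seq bool) : R := (ones r)%:R / (size r)%:R.

Lemma ones_le r : (ones r <= size r)%N. Proof. exact: count_size. Qed.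

Lemma smean01 (R : realType) r : 0 <= smean R r <= 1.
Proof.
rewrite /smean divr_ge0 ?ler0n //=; case: (posnP (size r)) => [->|r0].
  by rewrite invr0 mulr0.
by rewrite ler_pdivrMr ?ltr0n // mul1r ler_nat ones_le.
Qed.

(* Likelihood ratio of Bernoulli z against Bernoulli p. *)
Definition lratio (R : realType) (z p : R) (r : seq bool) : R :=
  (z / p) ^+ ones r * ((1 - z) / (1 - p)) ^+ (size r - ones r).

Lemma lratio_ge0 (R : realType) (z p : R) r :
  0 <= z <= 1 -> 0 < p < 1 -> 0 <= lratio z p r.
Proof.
move=> /andP[z0 z1] /andP[p0 p1].
by apply: mulr_ge0; apply: exprn_ge0; apply: divr_ge0; lra.
Qed.

(** One step multiplies the ratio on average by 1 + (z - p)(m - p) / (p (1 - p)). So the reference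
    [p] need not be the true mean [m]: it may lie anywhere between [m] and [z]. *)
Lemma lratio_super (R : realType) (m z p : R) r :
  0 <= z <= 1 -> 0 < p < 1 -> (z - p) * (m - p) <= 0 ->
  m * lratio z p (rcons r true) + (1 - m) * lratio z p (rcons r false)
    <= lratio z p r.
Proof.
move=> z01 p01 h.
have /andP[p0 p1] := p01.
have -> : lratio z p (rcons r true) = z / p * lratio z p r.
  by rewrite /lratio /ones -cats1 count_cat size_cat /= !addn1 subSS exprS mulrA.
have -> : lratio z p (rcons r false) = (1 - z) / (1 - p) * lratio z p r.
  rewrite /lratio /ones -cats1 count_cat size_cat /= addn1 !addn0.
  by rewrite subSn ?count_size // exprS mulrCA.
rewrite (mulrA m) (mulrA (1 - m)) -mulrDl; apply: ler_piMl; first exact: lratio_ge0.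
have -> : m * (z / p) + (1 - m) * ((1 - z) / (1 - p)) =
    1 + (z - p) * (m - p) / (p * (1 - p)).
  by field; apply/andP; split; apply/eqP; lra.
rewrite gerDl; apply: mulr_le0_ge0 => //; rewrite invr_ge0; apply: mulr_ge0; lra.
Qed.

(** The log-likelihood ratio is the sample size times [klr z p + (smean R r - z) * logodds z p], and
    [logodds z p] has the sign of z - p, so a mean at least as extreme as [z] only helps. For [z]
    equal to 0 or 1 the logarithms take default values, but then the hypothesis forces the mean to
    equal [z]. *)
Lemma lratio_ge (R : realType) (z p : R) r :
  0 <= z <= 1 -> 0 < p < 1 -> (0 < size r)%N -> 0 <= (z - p) * (smean R r - z) ->
  expR ((size r)%:R * klr z p) <= lratio z p r.
Proof.
move=> /andP[z0 z1] /andP[p0 p1] r0 zr.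
have n0 : 0 < (size r)%:R :> R by rewrite ltr0n.
have orE : (ones r)%:R = smean R r * (size r)%:R by rewrite divfK ?gt_eqF.
have /andP[m0 m1] := smean01 R r.
have [zE|zn0] := eqVneq z 0.
  have o0 : ones r = 0%N.
    apply/eqP; rewrite -(pnatr_eq0 R) orE; apply/eqP.
    have : smean R r = 0 by rewrite zE in zr; nra.
    by move=> ->; rewrite mul0r.
  rewrite /lratio o0 expr0 mul1r subn0 zE /klr mul0r add0r subr0 mul1r.
  by rewrite expRM_natl lnK // posrE divr_gt0 //; lra.
have [zE|zn1] := eqVneq z 1.
  have o0 : ones r = size r.
    apply/eqP; rewrite -(eqr_nat R) orE; apply/eqP.
    have : smean R r = 1 by rewrite zE in zr; nra.
    by move=> ->; rewrite mul1r.
  rewrite /lratio o0 subnn expr0 mulr1 zE /klr subrr !mul0r addr0 !mul1r.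
  by rewrite expRM_natl lnK // posrE invr_gt0.
have {}z0 : 0 < z by rewrite lt_neqAle eq_sym zn0.
have {}z1 : z < 1 by rewrite lt_neqAle zn1.
have zp0 : 0 < z / p by rewrite divr_gt0.
have zp1 : 0 < (1 - z) / (1 - p) by rewrite divr_gt0; lra.
have -> : lratio z p r = expR ((size r)%:R * (klr z p + (smean R r - z) * logodds z p)).
  rewrite /lratio -[z / p]lnK ?posrE // -[X in _ * X ^+ _]lnK ?posrE //.
  rewrite -!expRM_natl -expRD; congr expR.
  rewrite natrB ?ones_le // orE /klr /logodds; ring.
rewrite ler_expR ler_pM2l // lerDl.
case: (lerP z p) => zp.
  have := @logodds_sign R z p; rewrite z0 z1 p0 p1 => /(_ isT isT zp) h.
  have [->|zpn] := eqVneq z p.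
    by rewrite /logodds !divff ?subrr ?mulr0 //; apply/eqP; lra.
  have zlt : z < p by rewrite lt_neqAle zpn.
  apply: mulr_le0 => //; nra.
have h : 0 <= logodds z p.
  have := @logodds_sign R (1 - z) (1 - p).
  rewrite /logodds !subKr => /(_ _ _ _) H.
  suff : ln ((1 - z) / (1 - p)) - ln (z / p) <= 0 by lra.
  apply: H; lra.
apply: mulr_ge0 => //; nra.
Qed.

(** * Deviations of empirical means *)

Section Deviations.
Context (R : realType) (K : nat) (mu : 'I_K -> R) (rule : history K -> 'I_K).
Context (mu01 : forall i, 0 <= mu i <= 1).
Notation prhits := (@prhits R K mu rule).

Lemma prhits_lratio n i (z p c : R) (B : pred (seq bool)) :
  0 <= z <= 1 -> 0 < p < 1 -> (z - p) * (mu i - p) <= 0 ->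
  (forall r, (size r <= n)%N -> B r ->
     [/\ (0 < size r)%N, 0 <= (z - p) * (smean R r - z) & c <= (size r)%:R * klr z p]) ->
  prhits n i B <= expR (- c).
Proof.
move=> z01 p01 zpm BP.
apply: (@le_trans _ _ (prhits n i (fun r => (size r <= n)%N && B r))).
  by apply: prhits_le => // r ->.
pose L r := expR (- c) * lratio z p r.
have -> : expR (- c) = L [::] by rewrite /L /lratio /= !expr0 !mulr1.
apply: (@Ex_hits _ _ _ rule mu01 n i L) => [r|r|r /andP[rn /(BP _ rn)[r0 zr cr]]].
- by rewrite mulr_ge0 ?expR_ge0 ?lratio_ge0.
- rewrite /L mulrCA [X in _ + X]mulrCA -mulrDr ler_wpM2l ?expR_ge0 //.
  exact: lratio_super.
- rewrite /L expRN ler_pdivlMl ?expR_gt0 // mulr1.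
  by apply: le_trans (lratio_ge z01 p01 r0 zr); rewrite ler_expR.
Qed.

Lemma prhits_klr n i (p g N : R) : 0 < p < 1 -> p <= mu i -> 0 <= g ->
  prhits n i (fun r => [&& (0 < size r)%N, N <= (size r)%:R, smean R r <= p
                         & g <= klr (smean R r) p]) <= expR (- (N * g)).
Proof.
move=> p01 pmu g0; set B := fun r : seq bool => _.
pose F (a : 'I_n.+1 * 'I_n.+1) : R := a.1%:R / a.2%:R.
pose Q (a : 'I_n.+1 * 'I_n.+1) := [&& (a.1 <= a.2)%N, (0 < a.2)%N, N <= a.2%:R,
  F a <= p & g <= klr (F a) p].
pose pr (r : seq bool) : 'I_n.+1 * 'I_n.+1 := (inord (ones r), inord (size r)).
have prE r : (size r <= n)%N -> ((pr r).1 = ones r :> nat) * ((pr r).2 = size r :> nat).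
  by move=> rn; rewrite /= !inordK // ltnS // (leq_trans (ones_le r)).
have FE r : (size r <= n)%N -> F (pr r) = smean R r.
  by move=> rn; rewrite /F !prE.
have QE r : (size r <= n)%N -> Q (pr r) = B r.
  by move=> rn; rewrite /Q FE // !prE // ones_le.
have [a0 Qa0|noQ] := pickP Q; last first.
  by rewrite prhits0 ?expR_ge0 // => r rn; rewrite -QE // noQ.
have [z Qz zmax] : exists2 z, Q z & forall a, Q a -> F a <= F z.
  by case: (@arg_maxP _ _ _ a0 Q F Qa0) => z Qz zmax; exists z => // a /zmax.
have /and5P[z12 z0 Nz zp gz] := Qz.
have z01 : 0 <= F z <= 1.
  rewrite /F divr_ge0 ?ler0n //= ler_pdivrMr ?ltr0n // mul1r ler_nat //.
apply: (@prhits_lratio _ _ (F z) p) => //.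
  by rewrite mulr_le0_ge0 ?subr_le0 ?subr_ge0.
move=> r rn Br; have /and4P[r0 Nr rp gr] := Br; split=> //.
  by rewrite mulr_le0 ?subr_le0 // -FE // zmax // QE.
apply: (@le_trans _ _ ((size r)%:R * g)); first by rewrite ler_wpM2r.
by rewrite ler_wpM2l ?ler0n.
Qed.

(** The reference is the midpoint [mu i + u / 2], since [mu i] may be 0; this turns the exponent u^2
    / 2 into u^2 / 8. *)
Lemma prhits_mean_high n i (u : R) (k : nat) : 0 < u -> (0 < k)%N ->
  prhits n i (fun r => (k <= size r)%N && (mu i + u <= smean R r))
    <= expR (- (k%:R * (u ^+ 2 / 8))).
Proof.
move=> u0 k0; have /andP[m0 m1] := mu01 i.
have [z1|z1] := lerP (mu i + u) 1; last first.
  rewrite prhits0 ?expR_ge0 // => r rn; apply/negP => /andP[_].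
  by have /andP[_ r1] := smean01 R r; lra.
have p01 : 0 < mu i + u / 2 < 1 by apply/andP; split; lra.
apply: (@prhits_lratio _ _ (mu i + u) (mu i + u / 2)) => //.
- by apply/andP; split; lra.
- by nra.
move=> r rn /andP[kr zr]; split; first exact: leq_trans kr.
- by apply: mulr_ge0; lra.
apply: ler_pM; rewrite ?ler_nat ?divr_ge0 ?sqr_ge0 //.
have -> : u ^+ 2 / 8 = (mu i + u - (mu i + u / 2)) ^+ 2 / 2 by field.
by apply: klr_ge_sqr => //; apply/andP; split; lra.
Qed.

Lemma sum_expR_le (a : R) n : 0 < a ->
  \sum_(k < n) expR (- (k.+1%:R * a)) <= a^-1.
Proof.
(* The stronger bound, fit for induction, is the integral of e^(-a x) over [0, n]. *)
move=> a0; suff : \sum_(k < n) expR (- (k.+1%:R * a)) <= (1 - expR (- (n%:R * a))) / a.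
  by move=> /le_trans; apply; rewrite ler_pdivrMr // mulVf ?gt_eqF //.
elim: n => [|n IH]; first by rewrite big_ord0 mul0r oppr0 expR0 subrr mul0r.
rewrite big_ord_recr /=; apply: le_trans (lerD IH (lexx _)) _.
rewrite ler_pdivlMr // mulrDl divfK ?gt_eqF //.
have -> : expR (- (n%:R * a)) = expR (- (n.+1%:R * a)) * expR a.
  by rewrite -expRD; congr expR; rewrite -[in RHS]natr1; ring.
have := expR_ge1Dx a; have := expR_gt0 (- (n.+1%:R * a)).
by nra.
Qed.

Lemma sum_prhits_mean_high n m i (u : R) : 0 < u ->
  \sum_(k < m) prhits n i (fun r => (k.+1 <= size r)%N && (mu i + u <= smean R r))
    <= 8 / u ^+ 2.
Proof.
move=> u0; rewrite -[8 / _]invf_div.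
apply: le_trans (sum_expR_le m _); last by rewrite divr_gt0 ?exprn_gt0.
by apply: ler_sum => k _; exact: prhits_mean_high.
Qed.

End Deviations.

(** * The kl-UCB++ index *)

(** The exploration function g in the single variable x = R / (K n). *)
Definition explor (R : realType) (x : R) : R := logp (x * (logp x ^+ 2 + 1)).

Lemma logp_ge0 (R : realType) (x : R) : 0 <= logp x.
Proof. by rewrite /logp le_max lexx orbT. Qed.

Lemma logpE (R : realType) (x : R) : 1 <= x -> logp x = ln x.
Proof. by move=> x1; rewrite /logp max_l // ln_ge0. Qed.

Lemma le_logp (R : realType) (x y : R) : 0 < x -> x <= y -> logp x <= logp y.
Proof.
move=> x0 xy; rewrite /logp ge_max !le_max lexx orbT andbT.
by rewrite ler_ln ?posrE ?xy // (lt_le_trans x0).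
Qed.

Lemma explor_ge0 (R : realType) (x : R) : 0 <= explor x.
Proof. exact: logp_ge0. Qed.

Lemma le_explor (R : realType) (x y : R) : 0 < x -> x <= y -> explor x <= explor y.
Proof.
move=> x0 xy; have y0 := lt_le_trans x0 xy.
have l0 := logp_ge0 x; have lxy := le_logp x0 xy.
apply: le_logp; first by rewrite mulr_gt0 // ltr_wpDl ?sqr_ge0.
apply: ler_pM => //; [exact: ltW|by rewrite addr_ge0 ?sqr_ge0|].
by rewrite lerD2r ler_pXn2r // nnegrE logp_ge0.
Qed.

Lemma explorE (R : realType) (x : R) : 1 <= x ->
  explor x = ln x + ln (ln x ^+ 2 + 1).
Proof.
move=> x1; have x0 : 0 < x by lra.
rewrite /explor (logpE x1) logpE ?lnM ?posrE //.
  by rewrite ltr_wpDl ?sqr_ge0.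
by rewrite -[leLHS]mulr1 ler_pM // lerDr sqr_ge0.
Qed.

Lemma explor_le_ln (R : realType) (x : R) : 1 <= x -> explor x <= 3 * ln x.
Proof.
move=> x1; rewrite explorE //; have l0 := ln_ge0 x1; set l := ln x in l0 *.
have : ln (l ^+ 2 + 1) <= ln ((1 + l) ^+ 2).
  rewrite ler_ln ?posrE ?exprn_gt0 //; first by nra.
  - by rewrite ltr_wpDl ?sqr_ge0.
  - by lra.
rewrite lnXn; last by lra.
have : ln (1 + l) <= l by apply: le_ln1Dx; lra.
by rewrite -mulr_natr; lra.
Qed.

(** Here the factor log^2 + 1 of the index is spent: e^(-g) is 1 / (x (l^2 + 1)) with l = ln x,
    while g + 1 <= 3 l + 1 <= 3 (l^2 + 1). *)
Lemma explor_expR (R : realType) (x : R) : 1 <= x ->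
  (explor x + 1) * expR (- explor x) <= 3 / x.
Proof.
move=> x1; have x0 : 0 < x by lra.
have l0 := ln_ge0 x1; have := explor_le_ln x1.
have -> : expR (- explor x) = (x * (ln x ^+ 2 + 1))^-1.
  by rewrite explorE // expRN expRD !lnK // posrE // ltr_wpDl ?sqr_ge0.
set l := ln x in l0 * => h; have q0 : 0 < l ^+ 2 + 1 by rewrite ltr_wpDl ?sqr_ge0.
rewrite invfM mulrCA [_ * x^-1]mulrC ler_pM2l ?invr_gt0 // ler_pdivrMr //; nra.
Qed.

(** Makes the sum of b e^(-b) over halved values of b telescope through x / (1 + x), with a bound
    independent of the number of scales. It rests on e^b = (e^(b/2))^2 >= (1 + b/2)^2. *)
Lemma mul_expRN_le (R : realType) (b : R) : 0 <= b ->
  b * expR (- b) <= 4 * (b / (1 + b) - (b / 2) / (1 + b / 2)).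
Proof.
move=> b0; have h1 : 0 < 1 + b by lra. have h2 : 0 < 1 + b / 2 by lra.
have -> : 4 * (b / (1 + b) - (b / 2) / (1 + b / 2)) = b * (4 / ((1 + b) * (2 + b))).
  by field; apply/andP; split; apply/eqP; lra.
rewrite ler_wpM2l // expRN ler_pdivlMr ?mulr_gt0 //; last by lra.
rewrite ler_pdivrMl ?expR_gt0 //.
have : expR b = expR (b / 2) ^+ 2 by rewrite -expRM_natl; congr expR; field.
have := expR_ge1Dx (b / 2); nra.
Qed.

Section Index.
Context (R : realType) (K Rh : nat).

(** The index as a function of one arm's rewards alone, so that statements about it are events to
    which [hits] applies. *)
Definition sindex (r : seq bool) : R :=
  sup [set q : R | [/\ 0 <= q <= 1, smean R r <= q &
    ((size r)%:R%:E * kl (smean R r) q <= (explo R K Rh (size r))%:E)%E]].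

Lemma sindexE (h : history K) i : klucbpp_index R Rh h i = sindex (rewards h i).
Proof.
have -> : klucbpp_index R Rh h i = sup [set q : R | [/\ 0 <= q <= 1,
    (count_mem (i, true) h)%:R / (npulls h i)%:R <= q &
    ((npulls h i)%:R%:E * kl ((count_mem (i, true) h)%:R / (npulls h i)%:R) q
      <= (explo R K Rh (npulls h i))%:E)%E]] by [].
have -> : npulls h i = size (rewards h i) by rewrite size_map size_filter.
suff -> : count_mem (i, true) h = ones (rewards h i) by [].
rewrite /ones count_map count_filter; apply: eq_count => -[j b] /=.
by rewrite andbC xpair_eqE eqb_id.
Qed.

Let S r := [set q : R | [/\ 0 <= q <= 1, smean R r <= q &
    ((size r)%:R%:E * kl (smean R r) q <= (explo R K Rh (size r))%:E)%E]].

Lemma kl_id (x : R) : 0 <= x <= 1 -> kl x x = 0%E.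
Proof.
move=> /andP[x0 x1]; rewrite /kl /kl_term.
have [->|xn0] := eqVneq x 0; first by rewrite subr0 oner_eq0 divr1 ln1 mulr0 addr0.
rewrite divff // ln1 mulr0 add0e; case: eqVneq => // hn.
by rewrite divff // ln1 mulr0.
Qed.

Let S_mean r : S r (smean R r).
Proof.
split; rewrite ?smean01 // kl_id ?smean01 // mule0 lee_fin.
exact: logp_ge0.
Qed.

Let S_sup r : has_sup (S r).
Proof.
by split; [exists (smean R r); exact: S_mean | exists 1 => q [/andP[]]].
Qed.

Lemma sindex_ge_mean r : smean R r <= sindex r.
Proof. by apply: sup_upper_bound; [exact: S_sup|exact: S_mean]. Qed.

Lemma sindex_lt r v : (0 < size r)%N -> sindex r < v -> v < 1 ->
  smean R r < v /\ explo R K Rh (size r) < (size r)%:R * klr (smean R r) v.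
Proof.
move=> r0 rv v1; have mv := le_lt_trans (sindex_ge_mean r) rv.
have /andP[m0 _] := smean01 R r; split=> //.
rewrite ltNge; apply/negP => h.
have : v <= sindex r.
  apply: sup_upper_bound; first exact: S_sup.
  split; rewrite ?(ltW mv) //; first by apply/andP; split; lra.
  by rewrite kl_klr ?lee_fin //; apply/andP; split; lra.
by rewrite leNgt rv.
Qed.

Lemma sindex_gt r v : v < sindex r ->
  exists q, [/\ v < q, 0 <= q <= 1, smean R r <= q &
    ((size r)%:R%:E * kl (smean R r) q <= (explo R K Rh (size r))%:E)%E].
Proof.
move=> vr; have [q [q01 mq gq] vq] := sup_gt (ex_intro _ _ (S_mean r)) vr.
by exists q.
Qed.

(** The candidate [q = 1] above the mean is excluded because [kl] is +oo there and the count is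
    positive; any other candidate above the mean is interior, where [kl] is [klr]. *)
Lemma kl_index_feasible r (q : R) : (0 < size r)%N -> 0 <= q <= 1 -> smean R r <= q ->
  ((size r)%:R%:E * kl (smean R r) q <= (explo R K Rh (size r))%:E)%E ->
  smean R r = q \/ 0 < q < 1 /\ (size r)%:R * klr (smean R r) q <= explo R K Rh (size r).
Proof.
move=> r0 /andP[q0 q1] mq.
have /andP[m0 m1] := smean01 R r.
have [->|mnq] := eqVneq (smean R r) q; first by left.
have mq' : smean R r < q by rewrite lt_neqAle mnq.
have [->|qn1] := eqVneq q 1; last first.
  have q01 : 0 < q < 1 by rewrite (le_lt_trans m0) //= lt_neqAle qn1.
  by rewrite kl_klr // lee_fin; right.
rewrite /kl /kl_term subrr eqxx.
have -> : (1 - smean R r == 0) = false by apply/eqP; lra.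
rewrite oner_eq0; case: ifP => _.
  by rewrite add0e gt0_muley ?lte_fin ?ltr0n // leye_eq.
by rewrite addey // gt0_muley ?lte_fin ?ltr0n // leye_eq.
Qed.

Lemma sindex_le r : (0 < size r)%N ->
  sindex r <= smean R r + Num.sqrt (2 * explo R K Rh (size r) / (size r)%:R).
Proof.
move=> r0; have n0 : 0 < (size r)%:R :> R by rewrite ltr0n.
apply: ge_sup; first by exists (smean R r); exact: S_mean.
move=> q [q01 mq gq].
have [<-|[q01' {}gq]] := kl_index_feasible r0 q01 mq gq; first by rewrite lerDl sqrtr_ge0.
rewrite -lerBlDl -[leLHS]ger0_norm ?subr_ge0 // -sqrtr_sqr ler_wsqrtr //.
rewrite ler_pdivlMr //.
have := klr_ge_sqr (smean01 R r) q01'.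
have -> : (smean R r - q) ^+ 2 = (q - smean R r) ^+ 2 by ring.
move=> h; have : (size r)%:R * ((q - smean R r) ^+ 2 / 2) <= (size r)%:R * klr (smean R r) q.
  by rewrite ler_pM2l.
lra.
Qed.

End Index.

Lemma expR1_le4 (R : realType) : expR 1 <= 4 :> R.
Proof.
have -> : (1 : R) = 2%:R * 2^-1 by rewrite mulfV.
rewrite expRM_natl.
have h : expR (2^-1 : R) <= 2.
  have := expR_ge1Dx (- 2^-1 : R).
  rewrite expRN => h; have e0 := expR_gt0 (2^-1 : R).
  have : (1 + - 2^-1) * expR 2^-1 <= (expR (2^-1 : R))^-1 * expR 2^-1 by rewrite ler_pM2r.
  rewrite mulVf ?gt_eqF //; lra.
have : expR (2^-1 : R) * expR 2^-1 <= 2 * 2 by apply: ler_pM; rewrite ?expR_ge0.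
lra.
Qed.

Lemma truncn_bounds (R : realType) (x : R) : 0 <= x ->
  (Num.truncn x)%:R <= x /\ x < (Num.truncn x)%:R + 1.
Proof. by move=> /truncn_itv /andP[? ?]; rewrite natr1. Qed.

Lemma arith_slice (R : realType) (N x : R) (J : nat) : 0 < N -> (0 < J)%N ->
  N <= x <= 2 * N ->
  exists2 j, (j < J)%N & N * (1 + j%:R / J%:R) <= x <= N * (1 + j.+1%:R / J%:R).
Proof.
move=> N0 J0 /andP[Nx xN]; have J0' : 0 < J%:R :> R by rewrite ltr0n.
pose y := (x / N - 1) * J%:R.
have xE : x = N * (1 + y / J%:R).
  by rewrite /y; field; apply/andP; split; apply/eqP; lra.
have y0 : 0 <= y by rewrite mulr_ge0 ?subr_ge0 ?ler_pdivlMr ?mul1r // ltW.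
have yJ : y <= J%:R by apply: ler_piMl; [exact: ltW|rewrite lerBlDr ler_pdivrMr //; lra].
have [t1 t2] := truncn_bounds y0.
have bnd (j : nat) : j%:R <= y -> y <= j.+1%:R ->
    N * (1 + j%:R / J%:R) <= x <= N * (1 + j.+1%:R / J%:R).
  move=> h1 h2; rewrite xE !ler_pM2l // !lerD2l !ler_pM2r ?invr_gt0 //.
  by rewrite h1 h2.
have [tJ|Jt] := ltnP (Num.truncn y) J.
  by exists (Num.truncn y) => //; apply: bnd => //; rewrite -natr1 ltW.
(* Only the right end [y = J] of the scale is left; the closed last slice contains it. *)
exists J.-1; first by rewrite prednK.
apply: bnd; rewrite ?prednK //; apply: le_trans t1; rewrite ler_nat.
by rewrite (leq_trans (leq_pred _)).
Qed.

Lemma dyadic_scale (R : realType) (M x : R) k : 0 < M -> M / 2 ^+ k <= x <= M ->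
  (0 < k)%N ->
  exists2 j, (j < k)%N & M / 2 ^+ j.+1 <= x <= 2 * (M / 2 ^+ j.+1).
Proof.
have dE j : 2 * (M / 2 ^+ j.+1) = M / 2 ^+ j :> R.
  by rewrite exprS; field; rewrite expf_neq0 ?pnatr_eq0.
move=> M0; elim: k => [|k IH] // /andP[kx xM] _.
have [h|h] := lerP x (2 * (M / 2 ^+ k.+1)); first by exists k; rewrite ?kx.
case: k IH kx h => [|k] IH kx; rewrite dE => h.
  by move: h; rewrite expr0 divr1 ltNge xM.
have [] := IH => //; first by rewrite (ltW h).
by move=> j jk hj; exists j => //; exact: ltnW.
Qed.

(** * Probability that the index of an arm is ever too low *)

Section Low.
Context (R : realType) (K : nat) (mu : 'I_K -> R) (rule : history K -> 'I_K).
Context (mu01 : forall i, 0 <= mu i <= 1).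
Notation prhits := (@prhits R K mu rule).
Context (M u p : R) (M0 : 0 < M) (u0 : 0 < u) (p01 : 0 < p < 1).

(** With M = R / K, this follows from an index below p - u: moving the second argument of [klr] from
    p - u up to p gains u^2 / 2 per observation. *)
Definition low (r : seq bool) : bool :=
  [&& (0 < size r)%N, smean R r <= p &
   explor (M / (size r)%:R) + (size r)%:R * (u ^+ 2 / 2) <= (size r)%:R * klr (smean R r) p].

Lemma prhits_low_dyadic n i (N : R) : p <= mu i -> 0 < N -> 2 * N <= M ->
  prhits n i (fun r => low r && (N <= (size r)%:R <= 2 * N)) <=
  24 * N / M * expR (- (N * (u ^+ 2 / 2))).
Proof.
move=> pmu N0 NM; pose c := explor (M / (2 * N)).
have x1 : 1 <= M / (2 * N) by rewrite ler_pdivlMr ?mul1r //; lra.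
have c0 : 0 <= c by exact: explor_ge0.
have [t1 t2] := truncn_bounds c0.
(* [c] bounds the exploration function from below on the whole scale; taking about [c] slices keeps
   the loss per slice bounded. *)
pose J := (Num.truncn c).+1.
have J0 : 0 < J%:R :> R by rewrite ltr0n.
have cJ : c <= J%:R by rewrite /J -natr1 ltW.
have Jc : J%:R <= c + 1 by rewrite /J -natr1 lerD2r.
pose lo (j : nat) : R := N * (1 + j%:R / J%:R).
pose g (j : nat) : R := c / lo j.+1 + u ^+ 2 / 2.
have v0 : 0 < u ^+ 2 / 2 by rewrite divr_gt0 ?exprn_gt0.
have lo0 j : 0 < lo j by rewrite mulr_gt0 // ltr_pwDl // divr_ge0.
have g0 j : 0 <= g j by apply: addr_ge0; [apply: divr_ge0 => //; exact: ltW|exact: ltW].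
apply: (@le_trans _ _ (\sum_(j <- iota 0 J) prhits n i (fun r =>
    [&& (0 < size r)%N, lo j <= (size r)%:R, smean R r <= p & g j <= klr (smean R r) p]))).
  apply: prhits_le_sum => // r _ /andP[/and3P[r0 mp rg] rN].
  have n0 : 0 < (size r)%:R :> R by rewrite ltr0n.
  have [j jJ /andP[loj hij]] := arith_slice N0 (ltn0Sn (Num.truncn c)) rN.
  apply/hasP; exists j; first by rewrite mem_iota.
  rewrite r0 mp; apply/and3P; split=> //.
  have hc : c <= explor (M / (size r)%:R).
    apply: le_explor; first lra.
    have /andP[_ r2N] := rN.
    by rewrite ler_pM2l // lef_pV2 ?posrE // mulr_gt0.
  rewrite -(ler_pM2l n0); apply: le_trans rg; rewrite mulrDr lerD2r.
  apply: le_trans hc; rewrite mulrCA ler_piMr // ler_pdivrMr ?lo0 // mul1r //.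
apply: (@le_trans _ _ (\sum_(j <- iota 0 J) expR (1 - c - N * (u ^+ 2 / 2)))).
  apply: ler_sum => j _; apply: le_trans (prhits_klr _ mu01 _ _ p01 pmu (g0 j)) _.
  rewrite ler_expR /g mulrDr opprD; apply: lerD; last first.
    by rewrite lerN2 ler_pM2r //; apply: ler_peMr; [exact: ltW|rewrite lerDl divr_ge0].
  (* The ratio of the ends of slice [j] is 1 - 1 / (J + j + 1), so the exponent [c] drops by c / (J
     + j + 1), at most 1 because c <= J. *)
  rewrite lerNl opprB /lo.
  have j0 : 0 <= j%:R :> R by rewrite ler0n.
  set y := j%:R in j0 *; rewrite -natr1 -/y.
  have -> : N * (1 + y / J%:R) * (c / (N * (1 + (y + 1) / J%:R)))
    = c - c / (J%:R + y + 1).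
    by field; rewrite !gt_eqF //; lra.
  rewrite lerD2l lerN2 ler_pdivrMr; lra.
rewrite big_const_seq count_predT size_iota iter_addr_0 -[X in X <= _]mulr_natl.
have -> : expR (1 - c - N * (u ^+ 2 / 2)) =
    expR 1 * (expR (- c) * expR (- (N * (u ^+ 2 / 2)))).
  by rewrite -!expRD; congr expR; ring.
rewrite !mulrA ler_wpM2r ?expR_ge0 //.
have h := explor_expR x1; rewrite -/c in h.
have e4 := expR1_le4 R; have ec := expR_gt0 (- c); have e1 := expR_gt0 (1 : R).
(* The constant 24 is 4 (for e) times 3 (from [explor_expR]) times 2 (from 2 N). *)
apply: (@le_trans _ _ (4 * ((c + 1) * expR (- c)))).
  rewrite mulrAC -mulrA [X in _ <= X]mulrC.
  have -> : J%:R * (expR (- c) * expR 1) = J%:R * expR (- c) * expR 1 by rewrite mulrA.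
  apply: ler_pM => //; first by rewrite ler_pM2r.
apply: (@le_trans _ _ (4 * (3 / (M / (2 * N))))); first by rewrite ler_pM2l.
rewrite le_eqVlt; apply/orP; left; apply/eqP; field.
by rewrite !gt_eqF.
Qed.

Lemma prhits_low_tail n i : p <= mu i ->
  prhits n i (fun r => low r && (M <= (size r)%:R)) <= expR (- (M * (u ^+ 2 / 2))).
Proof.
move=> pmu; have v0 : 0 <= u ^+ 2 / 2 by rewrite divr_ge0 ?sqr_ge0.
apply: le_trans (prhits_klr _ mu01 _ _ p01 pmu v0).
apply: prhits_le => // r _ /andP[/and3P[r0 mp rg] ->]; rewrite r0 mp /=.
have n0 : 0 < (size r)%:R :> R by rewrite ltr0n.
rewrite -(ler_pM2l n0); apply: le_trans rg.
by rewrite lerDr explor_ge0.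
Qed.

Lemma prhits_low n i : p <= mu i -> prhits n i low <= 200 / (M * u ^+ 2).
Proof.
move=> pmu; have v0 : 0 < u ^+ 2 / 2 by rewrite divr_gt0 ?exprn_gt0.
(* The smallest scale starts below 1, so every nonempty sequence shorter than [M] falls into some
   scale. *)
have [k Mk] : exists k, M < 2 ^+ k.+1.
  have := archi_boundP (ltW M0); set k := Num.bound M => Mk.
  exists k; apply: lt_le_trans Mk _; rewrite -natrX ler_nat.
  by rewrite (leq_trans (ltnW (ltn_expl k (ltnSn 1)))) // leq_exp2l.
pose N j : R := M / 2 ^+ (j.+1).
pose b j := N j * (u ^+ 2 / 2).
have N0 j : 0 < N j by rewrite divr_gt0 ?exprn_gt0.
have b0 j : 0 < b j by rewrite mulr_gt0.
pose C (j : option nat) r := if j is Some j then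
   low r && (N j <= (size r)%:R <= 2 * N j) else low r && (M <= (size r)%:R).
apply: (@le_trans _ _ (\sum_(j <- None :: [seq Some j | j <- iota 0 k.+1])
    prhits n i (C j))).
  have sP j : (j \in iota 0 k.+1) = (j < k.+1)%N by rewrite mem_iota.
  move: (iota 0 k.+1) sP => s sP.
  apply: prhits_le_sum => // r _ lr /=; rewrite /C lr /=.
  case: lerP => //= rM; rewrite has_map.
  have /and3P[r0 _ _] := lr.
  have [] := @dyadic_scale _ M (size r)%:R k.+1 M0 => //.
    rewrite (ltW rM) andbT; apply: (@le_trans _ _ 1); last by rewrite ler1n.
    by rewrite ler_pdivrMr ?exprn_gt0 // mul1r ltW.
  by move=> j jk hj; apply/hasP; exists j; rewrite ?sP //= hj.
rewrite big_cons big_map.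
have A : 0 < M * u ^+ 2 by rewrite mulr_gt0 ?exprn_gt0.
have tail : prhits n i (C None) <= 2 / (M * u ^+ 2).
  apply: le_trans (prhits_low_tail n pmu) _; rewrite expRN.
  have -> : 2 / (M * u ^+ 2) = (M * (u ^+ 2 / 2))^-1.
    by rewrite -invf_div; congr (_^-1); field.
  rewrite lef_pV2 ?posrE ?expR_gt0 ?mulr_gt0 //.
  by have := expR_ge1Dx (M * (u ^+ 2 / 2)); lra.
pose psi (x : R) := x / (1 + x).
have dy j : prhits n i (C (Some j)) <= 192 / (M * u ^+ 2) * (psi (b j) - psi (b j.+1)).
  have bS : b j.+1 = b j / 2.
    by rewrite /b /N [2 ^+ j.+2]exprS; field; rewrite expf_neq0 ?pnatr_eq0.
  have NM : 2 * N j <= M.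
    have -> : 2 * N j = M / 2 ^+ j by rewrite /N exprS; field; rewrite expf_neq0 ?pnatr_eq0.
    by rewrite ler_pdivrMr ?exprn_gt0 //; apply: ler_peMr; [exact: ltW|rewrite exprn_ege1 ?ler1n].
  apply: le_trans (prhits_low_dyadic n pmu (N0 j) NM) _.
  have -> : 24 * N j / M * expR (- (N j * (u ^+ 2 / 2))) =
      48 / (M * u ^+ 2) * (b j * expR (- b j)).
    by rewrite /b; field; rewrite !gt_eqF.
  rewrite bS; have := mul_expRN_le (ltW (b0 j)).
  move=> h; set X := psi (b j) - psi (b j / 2).
  have {}h : b j * expR (- b j) <= 4 * X := h.
  have -> : 192 / (M * u ^+ 2) * X = 48 / (M * u ^+ 2) * (4 * X).
    by field; rewrite !gt_eqF.
  by rewrite ler_pM2l // divr_gt0.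
have tele m : \sum_(j <- iota 0 m) prhits n i (C (Some j)) <=
    192 / (M * u ^+ 2) * (psi (b 0%N) - psi (b m)).
  elim: m => [|m IH]; first by rewrite big_nil subrr mulr0.
  rewrite -addn1 iotaD big_cat /= big_seq1 add0n addn1.
  apply: le_trans (lerD IH (dy m)) _; rewrite -mulrDr.
  by rewrite ler_pM2l ?divr_gt0 //; lra.
have psi01 x : 0 < x -> 0 <= psi x <= 1.
  move=> x0; have h : 0 < 1 + x by lra.
  rewrite /psi ler_pdivrMr //; apply/andP; split; last by lra.
  by apply: divr_ge0; exact: ltW.
apply: le_trans (lerD tail (tele k.+1)) _.
(* 2 comes from the tail, 192 = 4 * 48 from the telescoping scales, and 6 is rounding. *)
have -> : 200 / (M * u ^+ 2) = 2 / (M * u ^+ 2) + 192 / (M * u ^+ 2) + 6 / (M * u ^+ 2).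
  by field; rewrite !gt_eqF.
have p1 := psi01 _ (b0 0%N); have p2 := psi01 _ (b0 k.+1).
have q1 : 192 / (M * u ^+ 2) * (psi (b 0%N) - psi (b k.+1)) <= 192 / (M * u ^+ 2).
  apply: ler_piMr; last by lra.
  by apply: divr_ge0 => //; exact: ltW.
have q2 : 0 <= 6 / (M * u ^+ 2) by apply: divr_ge0 => //; exact: ltW.
lra.
Qed.

End Low.

Section SIndexLow.
Context (R : realType) (K : nat) (mu : 'I_K -> R) (rule : history K -> 'I_K).
Context (mu01 : forall i, 0 <= mu i <= 1).

Definition low_index Rh (v : R) (r : seq bool) : bool :=
  (0 < size r)%N && (sindex R K Rh r < v).

Lemma prhits_low_index n i Rh (u : R) : 0 < u -> (0 < Rh)%N ->
  prhits mu rule n i (low_index Rh (mu i - u)) <= 800 * K%:R / (Rh%:R * u ^+ 2).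
Proof.
move=> u0 Rh0; have K0 : (0 < K)%N by apply: leq_ltn_trans (ltn_ord i).
have KR0 : 0 < K%:R :> R by rewrite ltr0n.
have RR0 : 0 < Rh%:R :> R by rewrite ltr0n.
have /andP[m0 m1] := mu01 i.
(* Here the level [mu i - u] is negative and the event empty. Otherwise [mu i - u / 2] is a valid
   reference even when [mu i = 1]; halving [u] turns 200 into 800. *)
have [up|up] := lerP (mu i) (u / 2).
  rewrite (prhits0 rule mu01); first by apply: divr_ge0; apply: mulr_ge0; rewrite ?ler0n ?sqr_ge0.
  move=> r _; apply/negP => /andP[_ h].
  have := sindex_ge_mean R K Rh r; have /andP[? _] := smean01 R r; lra.
have p01 : 0 < mu i - u / 2 < 1 by apply/andP; split; lra.
have u20 : 0 < u / 2 by lra.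
have M0 : 0 < Rh%:R / K%:R :> R by rewrite divr_gt0.
have -> : 800 * K%:R / (Rh%:R * u ^+ 2) = 200 / (Rh%:R / K%:R * (u / 2) ^+ 2).
  by field; rewrite !gt_eqF.
apply: le_trans (prhits_low rule mu01 M0 u20 p01 n _); last by lra.
apply: prhits_le => // r _ /andP[r0 ru].
have n0 : 0 < (size r)%:R :> R by rewrite ltr0n.
have v1 : mu i - u < 1 by lra.
have [mv gv] := sindex_lt r0 ru v1.
rewrite /low r0 /=; apply/andP; split; first by lra.
have /andP[s0 _] := smean01 R r.
have h : klr (smean R r) (mu i - u) + (mu i - u / 2 - (mu i - u)) ^+ 2 / 2
    <= klr (smean R r) (mu i - u / 2) by apply: klr_incr_r; lra.
have -> : Rh%:R / K%:R / (size r)%:R = Rh%:R / (K%:R * (size r)%:R) :> R.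
  by field; rewrite !gt_eqF.
rewrite -/(explo R K Rh (size r)).
have -> : (u / 2) ^+ 2 = (mu i - u / 2 - (mu i - u)) ^+ 2 by field.
move: h; rewrite -(ler_pM2l n0) mulrDr; apply: le_trans.
by rewrite lerD2r ltW.
Qed.

End SIndexLow.

(** * Pathwise regret *)

(** Layer-cake formula on a dyadic grid: a tail of order 1 / u^2 at the levels u = d 2^l sums to an
    expectation of order 1 / d. *)
Lemma le_dyadic_sum (R : realType) (d x : R) (L : nat) : 0 < d -> x <= d * 2 ^+ L ->
  x <= d + \sum_(l < L) d * 2 ^+ l * (d * 2 ^+ l < x)%R%:R.
Proof.
move=> d0; elim: L x => [|L IH] x; first by rewrite big_ord0 addr0 expr0 mulr1.
move=> xL; rewrite big_ord_recr /=; case: (lerP x (d * 2 ^+ L)) => h.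
  by rewrite mulr0 addr0; exact: IH.
rewrite mulr1 addrA -lerBlDr; have := IH (x - d * 2 ^+ L).
rewrite exprS in xL; move=> /(_ ltac:(lra)) /le_trans; apply.
rewrite lerD2l; apply: ler_sum => l _; apply: ler_wpM2l; first by rewrite mulr_ge0 ?exprn_ge0 // ltW.
rewrite ler_nat; case: (ltrP _ (x - _)) => // h1.
suff -> : d * 2 ^+ l < x by [].
by apply: lt_trans h1 _; rewrite gtrBl mulr_gt0 ?exprn_gt0.
Qed.

Lemma sum_geom_half (R : realType) (L : nat) : \sum_(l < L) (2 ^+ l)^-1 <= 2 :> R.
Proof.
suff : \sum_(l < L) (2 ^+ l)^-1 = 2 - 2 / 2 ^+ L :> R.
  by move=> ->; rewrite gerBl divr_ge0 ?exprn_ge0.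
elim: L => [|L IH]; first by rewrite big_ord0 expr0 divr1 subrr.
rewrite big_ord_recr /= IH exprS; field.
by rewrite expf_neq0 ?pnatr_eq0.
Qed.

(** Discrete form of the integral of x^(-3/4); the square roots are nested to obtain fourth
    roots. *)
Lemma le_telescope_root4 (R : realType) (n : nat) :
  (Num.sqrt (Num.sqrt n.+1%:R) ^+ 3)^-1
    <= 4 * (Num.sqrt (Num.sqrt n.+1%:R) - Num.sqrt (Num.sqrt n%:R)) :> R.
Proof.
set a := Num.sqrt (Num.sqrt n.+1%:R); set b := Num.sqrt (Num.sqrt n%:R).
have a0 : 0 < a by rewrite !sqrtr_gt0 ltr0n.
have b0 : 0 <= b by exact: sqrtr_ge0.
have ab : b <= a by rewrite !ler_wsqrtr // ler_nat.
have aE : a ^+ 4 = n.+1%:R by rewrite (exprM a 2 2) !sqr_sqrtr ?sqrtr_ge0.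
have bE : b ^+ 4 = n%:R by rewrite (exprM b 2 2) !sqr_sqrtr ?sqrtr_ge0.
have E : (a - b) * (a ^+ 3 + a ^+ 2 * b + a * b ^+ 2 + b ^+ 3) = 1.
  have -> : (a - b) * (a ^+ 3 + a ^+ 2 * b + a * b ^+ 2 + b ^+ 3) = a ^+ 4 - b ^+ 4 by ring.
  by rewrite aE bE -natr1; ring.
have a3 : 0 < a ^+ 3 by rewrite exprn_gt0.
rewrite -[leLHS]mul1r ler_pdivrMr // -[leLHS]E.
have -> : 4 * (a - b) * a ^+ 3 = (a - b) * (4 * a ^+ 3) by ring.
apply: ler_wpM2l; first by rewrite subr_ge0.
have h1 : a ^+ 2 * b <= a ^+ 2 * a by rewrite ler_wpM2l ?sqr_ge0.
have h2 : a * b ^+ 2 <= a * a ^+ 2.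
  by apply: ler_wpM2l; [exact: ltW|rewrite lerXn2r // nnegrE // ltW].
have h3 : b ^+ 3 <= a ^+ 3 by rewrite lerXn2r // nnegrE // ltW.
have -> : 4 * a ^+ 3 = a ^+ 3 + a ^+ 2 * a + a * a ^+ 2 + a ^+ 3 by ring.
lra.
Qed.

(** Since g(x) <= 3 ln x <= 6 sqrt x, each term is at most 4 M^(1/4) k^(-3/4), and the terms with k
    > M vanish. A logarithm bounded by a root leaves no logarithmic factor in the sum. *)
Lemma sum_bonus_le (R : realType) (M : R) (n : nat) : 0 < M ->
  \sum_(k < n) Num.sqrt (2 * explor (M / k.+1%:R) / k.+1%:R) <= 16 * Num.sqrt M.
Proof.
move=> M0; set m := Num.sqrt (Num.sqrt M).
have m0 : 0 < m by rewrite !sqrtr_gt0.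
have mE : m ^+ 2 = Num.sqrt M by rewrite sqr_sqrtr ?sqrtr_ge0.
(* The cap at [M] freezes the induction bound once the bonuses are zero. *)
pose Phi (x : R) := Num.sqrt (Num.sqrt (Num.min x M)).
suff H : \sum_(k < n) Num.sqrt (2 * explor (M / k.+1%:R) / k.+1%:R) <= 16 * m * Phi n%:R.
  apply: le_trans H _; rewrite -mE expr2 mulrA ler_wpM2l //; first by rewrite mulr_ge0 ?ltW.
  by rewrite !ler_wsqrtr // ge_min lexx orbT.
elim: n => [|n IH]; first by rewrite big_ord0 mulr_ge0 ?sqrtr_ge0 // mulr_ge0 ?ltW.
rewrite big_ord_recr /=; set y : R := n.+1%:R.
have y0 : 0 < y by rewrite ltr0n.
have Phi_mono : Phi n%:R <= Phi y.
  by rewrite !ler_wsqrtr // le_min2 // ler_nat.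
case: (lerP y M) => yM; last first.
  have -> : explor (M / y) = 0.
    apply/eqP; rewrite eq_le explor_ge0 andbT /explor.
    have x1 : M / y <= 1 by rewrite ler_pdivrMr // mul1r ltW.
    have l0 : logp (M / y) = 0 by rewrite /logp max_r // ln_le0.
    by rewrite l0 expr0n /= add0r mulr1 l0.
  rewrite mulr0 mul0r sqrtr0 addr0; apply: le_trans IH _.
  by rewrite ler_wpM2l // mulr_ge0 ?ltW.
have nM : n%:R <= M by apply: le_trans yM; rewrite ler_nat.
have PhiE (x : R) : x <= M -> Phi x = Num.sqrt (Num.sqrt x).
  by move=> xM; rewrite /Phi min_l.
rewrite (PhiE _ yM); rewrite (PhiE _ nM) in IH.
have := le_telescope_root4 R n; rewrite -/y.
set a := Num.sqrt (Num.sqrt y) => tel.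
have a0 : 0 < a by rewrite !sqrtr_gt0.
have aE2 : a ^+ 2 = Num.sqrt y by rewrite sqr_sqrtr ?sqrtr_ge0.
have aE : a ^+ 4 = y by rewrite (exprM a 2 2) aE2 sqr_sqrtr ?ltW.
have mE4 : m ^+ 4 = M by rewrite (exprM m 2 2) mE sqr_sqrtr ?ltW.
have term : Num.sqrt (2 * explor (M / y) / y) <= 4 * m * (a ^+ 3)^-1.
  have c0 : 0 <= 4 * m * (a ^+ 3)^-1 by rewrite mulr_ge0 ?mulr_ge0 ?invr_ge0 ?exprn_ge0 ?ltW.
  rewrite -[leRHS]ger0_norm // -sqrtr_sqr ler_wsqrtr //.
  have x1 : 1 <= M / y by rewrite ler_pdivlMr ?mul1r.
  have h1 := explor_le_ln x1.
  have am0 : 0 < (m / a) ^+ 2 by rewrite exprn_gt0 ?divr_gt0.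
  have h2 : ln (M / y) <= 2 * (m / a) ^+ 2.
    have -> : M / y = ((m / a) ^+ 2) ^+ 2.
      by rewrite -mE4 -aE; field; rewrite gt_eqF.
    rewrite lnXn // -[ln _ *+ 2]mulr_natl ler_pM2l //.
    by have := ln_leB1 am0; lra.
  (* The constant 6 is rounded up to 8 so that 2 * 8 is a square. *)
  have -> : (4 * m / a ^+ 3) ^+ 2 = 2 * (8 * (m / a) ^+ 2) / y.
    by rewrite -aE; field; rewrite gt_eqF.
  by rewrite ler_pM2r ?invr_gt0 // ler_pM2l //; lra.
apply: le_trans (lerD IH term) _.
have h : 4 * m * (a ^+ 3)^-1 <= 4 * m * (4 * (a - Num.sqrt (Num.sqrt n%:R))).
  by rewrite ler_pM2l // mulr_gt0.
lra.
Qed.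

Section Paths.
Context (R : realType) (K : nat).
Implicit Types (h : history K) (i : 'I_K).

Lemma rewards_cat h1 h2 i : rewards (h1 ++ h2) i = rewards h1 i ++ rewards h2 i.
Proof. by rewrite /rewards filter_cat map_cat. Qed.

Lemma size_rewards h i : size (rewards h i) = npulls h i.
Proof. by rewrite size_map size_filter. Qed.

Lemma sum_size_rewards h : (\sum_(i < K) size (rewards h i) = size h)%N.
Proof.
elim: h => [|x h IH] /=; first by rewrite big1.
rewrite -IH (bigD1 x.1) //= [in RHS](bigD1 x.1) //= -addSn; congr (_ + _)%N.
  by rewrite /rewards /= eqxx.
by apply: eq_bigr => j; rewrite eq_sym => /negbTE jx; rewrite /rewards /= jx.
Qed.

(** When arm [i] is pulled after [k] earlier pulls, its past is exactly [take k (rewards h i)]; a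
    cost bounded through the arm's own past can thus be summed arm by arm. *)
Lemma sum_by_arm (f : 'I_K -> R) (G : 'I_K -> seq bool -> R) h :
  (forall h1 x h2, h = rcons h1 x ++ h2 -> f x.1 <= G x.1 (rewards h1 x.1)) ->
  \sum_(x <- h) f x.1 <=
    \sum_(i < K) \sum_(k < size (rewards h i)) G i (take k (rewards h i)).
Proof.
elim/last_ind: h => [|h x IH] fG; first by rewrite big_nil big1 // => i _; rewrite big_ord0.
rewrite -cats1 big_cat big_seq1 /=.
have hf : f x.1 <= G x.1 (rewards h x.1) by apply: (fG _ _ [::]); rewrite cats0.
have {}IH := IH (fun h1 y h2 hE => fG h1 y (rcons h2 x) (etrans (f_equal (rcons^~ x) hE) (rcons_cat _ _ _))).
apply: le_trans (lerD IH hf) _.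
rewrite (bigD1 x.1) //= [leRHS](bigD1 x.1) //= addrAC.
rewrite cats1 rewards_rcons eqxx size_rcons big_ord_recr /=.
have -> : take (size (rewards h x.1)) (rcons (rewards h x.1) x.2) = rewards h x.1.
  by rewrite -cats1 take_size_cat.
rewrite le_eqVlt; apply/orP; left; apply/eqP; congr (_ + _ + _).
  by apply: eq_bigr => k _; rewrite -cats1 takel_cat // ltnW.
apply: eq_bigr => j jx; rewrite rewards_rcons eq_sym (negbTE jx) //.
Qed.

End Paths.

(** * Regret of the residual rule on the decision tree *)

Section Regret.
Context (R : realType) (K : nat) (mu : 'I_K -> R) (istar : 'I_K).
Context (T : nat) (rule : history K -> 'I_K).
Context (mu01 : forall i, 0 <= mu i <= 1) (mu_istar : mu istar = mustar mu).
Context (rule_ucb : is_klucbpp R T rule).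

Lemma Delta_ge0 i : 0 <= Delta mu i.
Proof. by rewrite subr_ge0 /mustar; apply: le_bigmax. Qed.

Lemma Delta_le1 i : Delta mu i <= 1.
Proof.
rewrite /Delta -mu_istar; have /andP[? ?] := mu01 i; have /andP[? ?] := mu01 istar; lra.
Qed.

Lemma consistent_uniq h : consistent rule h -> (size h <= K)%N -> uniq [seq x.1 | x <- h].
Proof.
elim/last_ind: h => [|h x IH] // /consistent_rconsE[ch xE]; rewrite size_rcons => hK.
rewrite map_rcons rcons_uniq IH // ?(ltnW hK) // andbT.
have := rule_ucb h; rewrite hK -xE /npulls => /eqP.
rewrite eqn0Ngt -has_count; apply: contra => /mapP[y yh yx].
by apply/hasP; exists y; rewrite //= yx.
Qed.

Lemma all_pulled h j : consistent rule h -> (K <= size h)%N -> (0 < npulls h j)%N.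
Proof.
move=> ch hK; have ct := @consistent_take _ _ _ K ch.
have st : size (take K h) = K by rewrite size_takel.
have un := consistent_uniq ct (eq_leq st).
have : j \in [seq x.1 | x <- take K h].
  have sub : {subset [seq x.1 | x <- take K h] <= enum 'I_K} by move=> x; rewrite mem_enum.
  have [|_ ->] := uniq_min_size un sub; first by rewrite size_enum_ord size_map st.
  by rewrite mem_enum.
case/mapP => y yt jE; rewrite /npulls -has_count; apply/hasP.
by exists y; [exact: mem_take yt|rewrite -jE /=].
Qed.

(** A repeated pull cannot belong to the first [K] rounds, where the rule picks unpulled arms; so it
    maximizes the index, and by then the best arm has been pulled. *)
Lemma pull_cases h1 x h2 : consistent rule (rcons h1 x ++ h2) ->
  (0 < size (rewards h1 x.1))%N ->
  (0 < size (rewards h1 istar))%N /\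
  sindex R K T (rewards h1 istar) <= sindex R K T (rewards h1 x.1).
Proof.
move=> ch; have xE := ch _ _ _ erefl.
have ch1 : consistent rule h1.
  by move=> g1 y g2 gE; apply: (ch g1 y (g2 ++ x :: h2)); rewrite gE cat_rcons catA.
have := rule_ucb h1; rewrite -xE !size_rewards; case: ltnP => [_ ->//|hK].
by move=> /(_ istar); rewrite !sindexE => h _; split=> //; exact: all_pulled.
Qed.

Lemma hits_prefix (B : pred (seq bool)) (h1 : history K) x (h2 : history K) i :
  B (rewards h1 i) -> hits B (rewards (rcons h1 x ++ h2) i).
Proof.
rewrite -cats1 -catA rewards_cat => Br; apply/hitsP.
exists (size (rewards h1 i)); first by rewrite size_cat leq_addr.
by rewrite take_size_cat.
Qed.

(** Replaces a sum over a random number of pulls by a fixed number of [hits] events, to which [Ex]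
    applies term by term. The empty prefix is left out: first pulls are charged separately. *)
Lemma sum_prefix_hits (G : seq bool -> R) (B : nat -> pred (seq bool)) (r : seq bool) m :
  (size r <= m)%N ->
  (forall k, (k < size r)%N -> (0 < k)%N -> G (take k r) <= (B k (take k r))%:R) ->
  \sum_(k < (size r).-1) G (take k.+1 r) <= \sum_(k < m) (hits (B k.+1) r)%:R.
Proof.
move=> rm GB.
apply: (@le_trans _ _ (\sum_(k < (size r).-1) (hits (B k.+1) r)%:R)).
  apply: ler_sum => k _; have kr : (k.+1 < size r)%N by have := ltn_ord k; lia.
  apply: le_trans (GB _ kr _) _ => //; rewrite ler_nat.
  case Bk: (B _ _) => //; suff -> : hits (B k.+1) r by [].
  by apply/hitsP; exists k.+1 => //; exact: ltnW.
have h : ((size r).-1 <= m)%N by lia.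
rewrite (big_ord_widen _ (fun k => (hits (B k.+1) r)%:R : R) h) big_mkcond /=.
by apply: ler_sum => k _; case: ifP.
Qed.

(* Optimism: a pull of arm a in round t costs
   mu* - mu_a <= (mu* - U_istar) + (U_a - mu_a). *)
Lemma regret_path (d : R) (L : nat) h : 0 < d -> 1 <= d * 2 ^+ L ->
  consistent rule h -> size h = T ->
  \sum_(x <- h) Delta mu x.1 <= K%:R
   + T%:R * (2 * d + \sum_(l < L) d * 2 ^+ l *
       (hits (low_index K T (mustar mu - d * 2 ^+ l)) (rewards h istar))%:R)
   + \sum_(i < K) \sum_(l < L) d * 2 ^+ l *
       \sum_(k < T) (hits (fun r => (k.+1 <= size r)%N && (mu i + d * 2 ^+ l <= smean R r))
          (rewards h i))%:R
   + \sum_(i < K) \sum_(k < T) Num.sqrt (2 * explo R K T k.+1 / k.+1%:R).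
Proof.
move=> d0 dL ch hT.
set W : R := \sum_(l < L) d * 2 ^+ l * (hits _ _)%:R.
pose bonus k := Num.sqrt (2 * explo R K T k / k%:R).
pose dev i r : R := \sum_(l < L) d * 2 ^+ l * (mu i + d * 2 ^+ l <= smean R r)%R%:R.
(* The first pull of each arm is charged 1, the source of the additive [K]. [W] refers to the full
   history, hence is the same for all pulls and bounds the deficit of the best index at every
   time. *)
pose G i r : R := if size r == 0%N then 1 else 2 * d + W + dev i r + bonus (size r).
have dl0 l : 0 <= d * 2 ^+ l by rewrite mulr_ge0 ?exprn_ge0 // ltW.
have W0 : 0 <= W by apply: sumr_ge0 => l _; rewrite mulr_ge0.
apply: le_trans (sum_by_arm (G := G) _) _.
  move=> h1 x h2 hE; rewrite /G; case: ifPn => [_|r0]; first exact: Delta_le1.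
  rewrite hE in ch; have := pull_cases ch; rewrite lt0n => /(_ r0)[s0 ss].
  set r := rewards h1 x.1 in ss r0 *; set s := rewards h1 istar in s0 ss.
  have h3 : mustar mu - sindex R K T s <= d + W.
    have -> : W = \sum_(l < L) d * 2 ^+ l *
       (hits (low_index K T (mustar mu - d * 2 ^+ l)) (rewards h istar))%:R by [].
    have := @le_dyadic_sum R d (mustar mu - sindex R K T s) L d0.
    have := sindex_ge_mean R K T s; have /andP[m0 _] := smean01 R s.
    have /andP[_ m1] := mu01 istar; rewrite -mu_istar => sm.
    move=> /(_ ltac:(lra)) /le_trans; apply; rewrite lerD2l.
    apply: ler_sum => l _; rewrite ler_wpM2l // ler_nat.
    case: ltP => // lt; rewrite hE hits_prefix //.
    by rewrite /low_index s0 /=; lra.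
  have h4 : smean R r - mu x.1 <= d + dev x.1 r.
    have := @le_dyadic_sum R d (smean R r - mu x.1) L d0.
    have /andP[_ m1] := smean01 R r; have /andP[m0 _] := mu01 x.1.
    move=> /(_ ltac:(lra)) /le_trans; apply; rewrite lerD2l.
    apply: ler_sum => l _; rewrite ler_wpM2l // ler_nat.
    case: ltP => // lt; suff -> : mu x.1 + d * 2 ^+ l <= smean R r by [].
    by lra.
  rewrite -lt0n in r0; have := @sindex_le R K T r r0; rewrite -/(bonus _).
  by rewrite /Delta; lra.
have armG i : \sum_(k < size (rewards h i)) G i (take k (rewards h i)) <=
    1 + (size (rewards h i))%:R * (2 * d + W) +
    \sum_(l < L) d * 2 ^+ l *
       \sum_(k < T) (hits (fun r => (k.+1 <= size r)%N && (mu i + d * 2 ^+ l <= smean R r))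
          (rewards h i))%:R
    + \sum_(k < T) bonus k.+1.
  set r := rewards h i.
  have rT : (size r <= T)%N by rewrite /r size_rewards -hT count_size.
  have A0 : 0 <= 2 * d + W by rewrite addr_ge0 // mulr_ge0 // ltW.
  have B0 : 0 <= \sum_(k < T) bonus k.+1.
    by apply: sumr_ge0 => k _; exact: sqrtr_ge0.
  have D0 : 0 <= \sum_(l < L) d * 2 ^+ l * \sum_(k < T) (hits (fun r =>
      (k.+1 <= size r)%N && (mu i + d * 2 ^+ l <= smean R r)) r)%:R.
    by apply: sumr_ge0 => l _; rewrite mulr_ge0 // sumr_ge0.
  case: (posnP (size r)) => [->|r0].
    by rewrite big_ord0 mul0r; lra.
  rewrite -(prednK r0) big_ord_recl take0 {1}/G /=.
  have [A AE] : exists A, A = 2 * d + W by exists (2 * d + W).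
  rewrite -AE in A0 *.
  have GE (k : 'I_(size r).-1) : G i (take (bump 0 k) r) =
      A + dev i (take k.+1 r) + bonus k.+1.
    have kr : (k.+1 <= size r)%N by have := ltn_ord k; lia.
    by rewrite AE /G /bump add1n size_takel.
  under eq_bigr do rewrite GE.
  rewrite !big_split /= sumr_const card_ord -!addrA lerD2l.
  apply: lerD; last apply: lerD.
  - by rewrite prednK // -[A *+ _]mulr_natl ler_wpM2r // ler_nat leq_pred.
  - rewrite exchange_big /=; apply: ler_sum => l _; rewrite -mulr_sumr ler_wpM2l //.
    apply: (@sum_prefix_hits (fun r => (mu i + d * 2 ^+ l <= smean R r)%R%:R)
      (fun k r => (k <= size r)%N && (mu i + d * 2 ^+ l <= smean R r))) => // k kr _.
    by rewrite size_takel ?(ltnW kr) // leqnn.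
  - have nT : ((size r).-1 <= T)%N by lia.
    rewrite (big_ord_widen _ (fun k => bonus k.+1) nT) big_mkcond /=.
    by apply: ler_sum => k _; case: ifP => // _; exact: sqrtr_ge0.
apply: le_trans (ler_sum _ (fun i _ => armG i)) _.
rewrite !big_split /= -mulr_suml sumr_const card_ord -natr_sum sum_size_rewards hT.
by [].
Qed.

(** The choice d = sqrt (K / T) balances T d against K / d. The constant is 1634 = 2 + 1600 + 16 +
    16: grid resolution, low index of the best arm, high empirical means, and bonuses. *)
Lemma Ex_regret_minimax :
  Ex mu rule T (fun h => \sum_(x <- h) Delta mu x.1) [::]
    <= 1634 * Num.sqrt (K%:R * T%:R) + K%:R.
Proof.
case: (posnP T) => [->|T0].
  rewrite /= big_nil; apply: addr_ge0; last exact: ler0n.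
  by apply: mulr_ge0; [exact: ler0n|exact: sqrtr_ge0].
have K0 : (0 < K)%N by apply: leq_ltn_trans (ltn_ord istar).
have KR0 : 0 < K%:R :> R by rewrite ltr0n.
have TR0 : 0 < T%:R :> R by rewrite ltr0n.
set S := Num.sqrt (K%:R * T%:R).
have S0 : 0 < S by rewrite sqrtr_gt0 mulr_gt0.
have SE : S ^+ 2 = K%:R * T%:R by rewrite sqr_sqrtr // mulr_ge0 // ltW.
pose d := S / T%:R.
have d0 : 0 < d by rewrite divr_gt0.
have [L dL] : exists L, 1 <= d * 2 ^+ L.
  have := archi_boundP (ltW (divr_gt0 ltr01 d0)); set L := Num.bound _ => h.
  exists L; rewrite mulrC -ler_pdivrMr //; apply: le_trans (ltW h) _.
  by rewrite -natrX ler_nat ltnW // ltn_expl.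
pose c l := d * 2 ^+ l.
have c0 l : 0 < c l by rewrite mulr_gt0 ?exprn_gt0.
apply: le_trans (@Ex_le _ _ _ _ mu01 _ _ _ _ (@consistent_nil _ _)
  (fun h ch hT => regret_path d0 dL ch hT)) _.
rewrite !ExD ExZ ExD !Ex_cst Ex_sum [X in _ + X + _]Ex_sum.
set A := \sum_(l < L) _; set B := \sum_(i < K) Ex _ _ _ _ _.
set D := \sum_(i < K) _.
have c2 l : 0 < (2 ^+ l)^-1 :> R by rewrite invr_gt0 exprn_gt0.
have hA : A <= 2 * (800 * (K%:R / (T%:R * d))).
  apply: (@le_trans _ _ (\sum_(l < L) 800 * (K%:R / (T%:R * d)) * (2 ^+ l)^-1)).
    apply: ler_sum => l _; rewrite ExZ -/(c l).
    apply: (@le_trans _ _ (c l * (800 * K%:R / (T%:R * c l ^+ 2)))).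
      by rewrite ler_pM2l // -mu_istar; exact: prhits_low_index.
    rewrite le_eqVlt; apply/orP; left; apply/eqP; rewrite /c; field.
    by rewrite !gt_eqF ?exprn_gt0.
  rewrite -mulr_sumr [leRHS]mulrC; apply: ler_wpM2l; last exact: sum_geom_half.
  apply: mulr_ge0; first exact: ler0n.
  by apply: divr_ge0; [exact: ltW|apply: ltW; apply: mulr_gt0].
have hB : B <= K%:R * (16 / d).
  apply: (@le_trans _ _ (\sum_(i < K) (16 / d))); last first.
    by rewrite sumr_const card_ord -[leLHS]mulr_natl.
  apply: ler_sum => i _; rewrite Ex_sum.
  apply: (@le_trans _ _ (\sum_(l < L) 8 / d * (2 ^+ l)^-1)).
    apply: ler_sum => l _; rewrite ExZ Ex_sum -/(c l).
    apply: (@le_trans _ _ (c l * (8 / c l ^+ 2))).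
      by rewrite ler_pM2l //; exact: sum_prhits_mean_high.
    rewrite le_eqVlt; apply/orP; left; apply/eqP; rewrite /c; field.
    by rewrite !gt_eqF ?exprn_gt0.
  have -> : 16 / d = 8 / d * 2 by field; rewrite gt_eqF.
  rewrite -mulr_sumr; apply: ler_wpM2l; last exact: sum_geom_half.
  by rewrite divr_ge0 // ltW.
have hD : D <= K%:R * (16 * (S / K%:R)).
  apply: (@le_trans _ _ (\sum_(i < K) (16 * (S / K%:R)))); last first.
    by rewrite sumr_const card_ord -[leLHS]mulr_natl.
  apply: ler_sum => i _.
  have <- : Num.sqrt (T%:R / K%:R) = S / K%:R.
    have -> : T%:R / K%:R = (S / K%:R) ^+ 2.
      by rewrite expr_div_n SE; field; rewrite gt_eqF.
    by rewrite sqrtr_sqr ger0_norm // divr_ge0 // ltW.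
  apply: le_trans (sum_bonus_le T (divr_gt0 TR0 KR0)).
  apply: ler_sum => k _; apply: ler_wsqrtr.
  have -> : T%:R / K%:R / k.+1%:R = T%:R / (K%:R * k.+1%:R) :> R.
    by field; rewrite !gt_eqF ?ltr0n.
  by [].
have eA : T%:R * (2 * (800 * (K%:R / (T%:R * d)))) = 1600 * S.
  have -> : T%:R * (2 * (800 * (K%:R / (T%:R * d)))) = 1600 * (K%:R * T%:R) / S.
    by rewrite /d; field; rewrite !gt_eqF.
  by rewrite -SE; field; rewrite gt_eqF.
have ed : T%:R * (2 * d) = 2 * S by rewrite /d; field; rewrite gt_eqF.
have eB : K%:R * (16 / d) = 16 * S.
  have -> : K%:R * (16 / d) = 16 * (K%:R * T%:R) / S.
    by rewrite /d; field; rewrite !gt_eqF.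
  by rewrite -SE; field; rewrite gt_eqF.
have eD : K%:R * (16 * (S / K%:R)) = 16 * S by field; rewrite gt_eqF.
have hTA : T%:R * A <= T%:R * (2 * (800 * (K%:R / (T%:R * d)))) by rewrite ler_pM2l.
rewrite mulrDr ed; rewrite eA in hTA; rewrite eB in hB; rewrite eD in hD.
lra.
Qed.

(** If the best index is ever low, all [T] rounds are given up. Otherwise each repeated pull of [i]
    has a high empirical mean, or an index that can reach the best one only while the count is at
    most [n0]. *)
Lemma pulls_path (d : R) i h : 0 < d -> consistent rule h -> size h = T ->
  0 < mu i + d -> mu i + d < mustar mu - 2 * d -> (0 < T)%N ->
  (size (rewards h i))%:R <= 1
   + explor T%:R / klr (mu i + d) (mustar mu - 2 * d)
   + T%:R * (hits (low_index K T (mustar mu - d)) (rewards h istar))%:R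
   + \sum_(k < T) (hits (fun r => (k.+1 <= size r)%N && (mu i + d <= smean R r))
          (rewards h i))%:R.
Proof.
move=> d0 ch hT md0 gap T0.
have K0 : (0 < K)%N by apply: leq_ltn_trans (ltn_ord istar).
have TR0 : 0 < T%:R :> R by rewrite ltr0n.
have /andP[_ s1] := mu01 istar; rewrite mu_istar in s1.
set X : R := (hits _ _)%:R.
set kl0 := klr _ _.
have kl0_gt0 : 0 < kl0.
  have h1 : (mu i + d - (mustar mu - 2 * d)) ^+ 2 / 2 <= kl0 by apply: klr_ge_sqr; lra.
  apply: lt_le_trans h1; rewrite divr_gt0 // exprn_even_gt0 //= subr_eq0.
  by apply/eqP; lra.
set n0 := explor T%:R / kl0.
have n00 : 0 <= n0 by rewrite divr_ge0 ?explor_ge0 // ltW.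
pose hi r : R := (mu i + d <= smean R r)%R%:R.
pose few (r : seq bool) : R := ((size r)%:R <= n0)%R%:R.
pose G (j : 'I_K) r : R := if j == i then
  (if size r == 0%N then 1 else X + hi r + few r) else 0.
have few_hi r : (0 < size r)%N -> mustar mu - d <= sindex R K T r -> 1 <= hi r + few r.
  move=> r0 ir; rewrite /hi /few; case: (lerP (mu i + d)) => [_|low]; first by rewrite lerDl.
  suff -> : (size r)%:R <= n0 by rewrite add0r.
  (* The supremum need not be attained; the second [d] leaves room for a feasible [q] strictly above
     the level. *)
  have [q [vq q01 mq gq]] := @sindex_gt R K T r (mustar mu - 2 * d) ltac:(lra).
  have /andP[m0 m1] := smean01 R r.
  have [E|[{}q01 {}gq]] := kl_index_feasible r0 q01 mq gq; first by lra.
  rewrite ler_pdivlMr //; apply: (@le_trans _ _ (explo R K T (size r))).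
    apply: le_trans gq; rewrite ler_pM2l ?ltr0n //.
    apply: (@le_trans _ _ (klr (smean R r) (mustar mu - 2 * d))).
      by apply: klr_decr_l; lra.
    have := @klr_incr_r R (smean R r) (mustar mu - 2 * d) q.
    move=> /(_ ltac:(lra) ltac:(lra) ltac:(lra) ltac:(lra) ltac:(lra)).
    by have := sqr_ge0 (q - (mustar mu - 2 * d)); lra.
  have Kr0 : (0 < K * size r)%N by rewrite muln_gt0 K0.
  rewrite /explo -natrM; apply: le_explor; first by rewrite divr_gt0 // ltr0n.
  by rewrite ler_pdivrMr ?ltr0n // ler_peMr // ler1n.
have -> : (size (rewards h i))%:R = \sum_(x <- h) (x.1 == i)%:R :> R.
  rewrite size_map size_filter -sum1_count natr_sum big_mkcond /=.
  by apply: eq_bigr => x _; case: eqP.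
apply: le_trans (sum_by_arm (G := G) (f := fun j => (j == i)%:R) _) _.
  move=> h1 x h2 hE; rewrite /G; case: eqP => // xi; case: ifPn => // r0.
  rewrite hE in ch; have := pull_cases ch; rewrite lt0n => /(_ r0)[s0 ss].
  rewrite -lt0n in r0.
  have [lowi|hii] := ltrP (sindex R K T (rewards h1 istar)) (mustar mu - d).
    have -> : X = 1.
      rewrite /X hE hits_prefix // /low_index s0 lowi //.
    by rewrite -addrA lerDl addr_ge0.
  have := few_hi _ r0 (le_trans hii ss).
  by rewrite -addrA => /le_trans; apply; rewrite lerDr.
rewrite (bigD1 i) //= [X in _ + X]big1 ?addr0; last first.
  by move=> j ji; rewrite big1 // => k _; rewrite /G (negbTE ji).
set r := rewards h i.
have rT : (size r <= T)%N by rewrite /r size_rewards -hT count_size.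
set Hs := \sum_(k < T) _.
have Hs0 : 0 <= Hs by apply: sumr_ge0.
have X0 : 0 <= X by rewrite ler0n.
have TX0 : 0 <= T%:R * X by rewrite mulr_ge0.
case: (posnP (size r)) => [->|r0]; first by rewrite big_ord0; lra.
rewrite -(prednK r0) big_ord_recl take0 {1}/G /= eqxx /=.
have GE (k : 'I_(size r).-1) : G i (take (bump 0 k) r) =
    X + hi (take k.+1 r) + (k.+1%:R <= n0)%R%:R.
  have kr : (k.+1 <= size r)%N by have := ltn_ord k; lia.
  by rewrite /G eqxx /few /bump add1n size_takel.
under eq_bigr do rewrite GE.
rewrite !big_split /= sumr_const card_ord.
have a1 : X *+ (size r).-1 <= T%:R * X.
  by rewrite -[leLHS]mulr_natl ler_wpM2r // ler_nat; lia.
have a2 : \sum_(k < (size r).-1) hi (take k.+1 r) <= Hs.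
  apply: (@sum_prefix_hits hi
    (fun k r => (k <= size r)%N && (mu i + d <= smean R r))) => // k kr _.
  by rewrite size_takel ?(ltnW kr) // leqnn.
have a3 m : \sum_(k < m) (k.+1%:R <= n0)%R%:R <= n0 :> R.
  suff : \sum_(k < m) (k.+1%:R <= n0)%R%:R <= Num.min n0 m%:R :> R.
    by move=> /le_trans; apply; rewrite ge_min lexx.
  elim: m => [|m IH]; first by rewrite big_ord0 le_min n00 lexx.
  rewrite big_ord_recr /=; move: IH; rewrite !le_min => /andP[I1 I2].
  have mS : m.+1%:R = m%:R + 1 :> R by rewrite natr1.
  case: (lerP m.+1%:R n0) => h1 /=; last by rewrite addr0 I1 mS; lra.
  by apply/andP; split; lra.
by have := a3 (size r).-1; lra.
Qed.

Lemma Ex_pulls_le (d : R) i : 0 < d -> (0 < T)%N ->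
  0 < mu i + d -> mu i + d < mustar mu - 2 * d ->
  Ex mu rule T (fun h => (size (rewards h i))%:R) [::] <= 1
   + explor T%:R / klr (mu i + d) (mustar mu - 2 * d)
   + (800 * K%:R + 8) / d ^+ 2.
Proof.
move=> d0 T0 md0 gap; have TR0 : 0 < T%:R :> R by rewrite ltr0n.
apply: le_trans (@Ex_le _ _ _ _ mu01 _ _ _ _ (@consistent_nil _ _)
  (fun h ch hT => pulls_path d0 ch hT md0 gap T0)) _.
rewrite !ExD !Ex_cst ExZ Ex_sum -addrA lerD2l mulrDl; apply: lerD; last first.
  exact: sum_prhits_mean_high.
have -> : 800 * K%:R / d ^+ 2 = T%:R * (800 * K%:R / (T%:R * d ^+ 2)).
  by field; rewrite !gt_eqF.
by rewrite ler_pM2l // -mu_istar; exact: prhits_low_index.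
Qed.

End Regret.

(** * Law of the reward table *)

Section Law.
Context (R : realType) (K : nat) (mu : 'I_K -> R).
Context d (Omega : measurableType d) (P : probability Omega R).
Context (Y : nat -> 'I_K -> {RV P >-> bool}).
Context (mu01 : forall i, 0 <= mu i <= 1) (Yb : bernoulli_rewards mu Y).

Lemma reward_prob t i (b : bool) :
  P (Y t i @^-1` [set b]) = (if b then mu i else 1 - mu i)%:E.
Proof.
have := Yb.1 t i [set b]; rewrite /distribution /pushforward => ->.
rewrite bernoulli_probE // !diracE /unstable.onem.
have -> : (true \in [set b]) = b by case: b; [rewrite mem_set|rewrite memNset].
have -> : (false \in [set b]) = ~~ b by case: b; [rewrite memNset|rewrite mem_set].
by case: b; rewrite /= ?mule1 ?mule0 ?adde0 ?add0e.
Qed.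

(** Cylinder events, one prescribed reward per listed cell of the table; distinct cells make the
    probability a product. *)
Definition cyl (J : seq ((nat * 'I_K) * bool)) : set Omega :=
  [set w | all (fun x => Y x.1.1 x.1.2 w == x.2) J].

Lemma cyl_cons x J : cyl (x :: J) = Y x.1.1 x.1.2 @^-1` [set x.2] `&` cyl J.
Proof.
by apply/seteqP; split=> w /=; [move=> /andP[/eqP]|move=> [/eqP Yx Yw]; apply/andP].
Qed.

Lemma measurable_reward t i (b : bool) : measurable (Y t i @^-1` [set b]).
Proof. by rewrite -[X in measurable X]setTI; exact: measurable_funP. Qed.

Lemma measurable_cyl J : measurable (cyl J).
Proof.
elim: J => [|x J IH]; last by rewrite cyl_cons; apply: measurableI => //; exact: measurable_reward.
by rewrite (_ : cyl [::] = setT) //; apply/seteqP.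
Qed.

Lemma uniq_fst_inj (A B : eqType) (J : seq (A * B)) a b b' :
  uniq [seq x.1 | x <- J] -> (a, b) \in J -> (a, b') \in J -> b = b'.
Proof.
elim: J => [|x J IH] //= /andP[xJ uJ]; rewrite !inE.
move=> /predU1P[xE|h1] /predU1P[xE'|h2]; last exact: IH.
- by move: xE'; rewrite -xE => -[].
- by move: xJ; rewrite -xE (map_f fst h2).
- by move: xJ; rewrite -xE' (map_f fst h1).
Qed.

Lemma prob_cyl J : uniq [seq x.1 | x <- J] ->
  P (cyl J) = (\prod_(x <- J) (if x.2 then mu x.1.2 else 1 - mu x.1.2))%:E.
Proof.
move=> uJ; pose B j := [set b | (j, b) \in J].
have BE x : x \in J -> B x.1 = [set x.2].
  move=> xJ; rewrite (surjective_pairing x) in xJ.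
  by apply/seteqP; split=> b /= => [bJ|->]; [exact: (uniq_fst_inj uJ bJ xJ)|].
have -> : cyl J = \bigcap_(j in [set` [seq x.1 | x <- J]])
    ((fun ti : nat * 'I_K => Y ti.1 ti.2) j @^-1` B j).
  apply/seteqP; split=> w /=.
    move=> /allP h j /= /mapP[x xJ ->]; rewrite /preimage /= BE //=.
    by apply/eqP; exact: h.
  move=> h; apply/allP => x xJ; apply/eqP.
  by have := h x.1 (map_f fst xJ); rewrite /preimage /= BE.
rewrite (Yb.2 _ B uJ) // big_map -prodEFin big_seq [RHS]big_seq.
by apply: eq_bigr => x xJ; rewrite BE // reward_prob.
Qed.

Fixpoint value (B : nat) (rule : history K -> 'I_K)
    (s : seq ('I_B * option 'I_K)) (h : history K) : R :=
  match s with
  | [::] => 0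
  | (_, Some i) :: s' => mu i + value rule s' h
  | (_, None) :: s' => mu (rule h) +
      (mu (rule h) * value rule s' (rcons h (rule h, true)) +
       (1 - mu (rule h)) * value rule s' (rcons h (rule h, false)))
  end.

Definition gain B rule t h (s : seq ('I_B * option 'I_K)) (w : Omega) : R :=
  \sum_(ba <- play rule (fun t i => Y t i w) t h s) mu ba.2.

Lemma gain_ge0 B rule t h (s : seq ('I_B * option 'I_K)) w : 0 <= gain rule t h s w.
Proof. by apply: sumr_ge0 => ba _; have /andP[] := mu01 ba.2. Qed.

Lemma gain_mandatory B rule t h b i (s : seq ('I_B * option 'I_K)) w :
  gain rule t h ((b, Some i) :: s) w = mu i + gain rule t.+1 h s w.
Proof. by rewrite /gain /= big_cons. Qed.

Lemma gain_residual B rule t h b (s : seq ('I_B * option 'I_K)) w :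
  gain rule t h ((b, None) :: s) w =
    mu (rule h) + gain rule t.+1 (rcons h (rule h, Y t (rule h) w)) s w.
Proof. by rewrite /gain /= big_cons. Qed.

Lemma measurable_gain B rule t h (s : seq ('I_B * option 'I_K)) :
  measurable_fun setT (gain rule t h s).
Proof.
elim: s t h => [|[b [i|]] s IH] t h.
- by rewrite (_ : gain _ _ _ _ = cst 0) // funeqE => w; rewrite /gain /= big_nil.
- rewrite (_ : gain _ _ _ _ = (fun w => mu i + gain rule t.+1 h s w)).
    exact: measurable_funD.
  by rewrite funeqE => w; exact: gain_mandatory.
- rewrite (_ : gain _ _ _ _ = (fun w => mu (rule h) + (if Y t (rule h) w
      then gain rule t.+1 (rcons h (rule h, true)) s w
      else gain rule t.+1 (rcons h (rule h, false)) s w))).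
    apply: measurable_funD => //; apply: measurable_fun_ifT => //.
  by rewrite funeqE => w; rewrite gain_residual; case: (Y t _ w).
Qed.

Lemma measurable_EFin_gain B rule t h (s : seq ('I_B * option 'I_K)) D :
  measurable_fun D (fun w => (gain rule t h s w)%:E).
Proof.
apply/measurable_EFinP; apply: measurable_funTS.
exact: measurable_gain.
Qed.

Lemma fin_mule_distr (p m v : R) (X : \bar R) : X = p%:E ->
  (m%:E * X + X * v%:E = X * (m + v)%:E)%E.
Proof. by move=> ->; rewrite -!EFinM -EFinD; congr EFin; ring. Qed.

(** Conditioning without conditional expectation: [J] constrains only rounds before [t], so the cell
    read at a residual round [t] is fresh and splits the cylinder in two, with weights given by
    independence. *)
Lemma integral_gain B rule t h (s : seq ('I_B * option 'I_K)) J :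
  uniq [seq x.1 | x <- J] -> (forall x, x \in J -> (x.1.1 < t)%N) ->
  (\int[P]_(w in cyl J) (gain rule t h s w)%:E = P (cyl J) * (value rule s h)%:E)%E.
Proof.
elim: s t h J => [|[b [i|]] s IH] t h J uJ tJ.
- rewrite mule0; apply: integral0_eq => w _.
  by rewrite /gain /= big_nil.
- rewrite (eq_integral (fun w => (mu i)%:E + (gain rule t.+1 h s w)%:E)%E); last first.
    by move=> w _; rewrite gain_mandatory EFinD.
  have /andP[m0 _] := mu01 i.
  rewrite ge0_integralD //=.
  + rewrite integral_cst //; last exact: measurable_cyl.
    rewrite IH //; last by move=> x /tJ /ltnW.
    exact: fin_mule_distr (prob_cyl _).
  + exact: measurable_cyl.
  + by move=> w _; rewrite lee_fin gain_ge0.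
  + exact: measurable_EFin_gain.
- set a := rule h; pose Jb c := ((t, a), c) :: J.
  have tnJ : (t, a) \notin [seq x.1 | x <- J].
    by apply/negP => /mapP[x /tJ h1 E]; move: h1; rewrite -E /= ltnn.
  have uJb c : uniq [seq x.1 | x <- Jb c] by rewrite /= tnJ.
  have tJb c x : x \in Jb c -> (x.1.1 < t.+1)%N.
    by rewrite inE => /predU1P[->|/tJ /ltnW].
  have split : cyl J = cyl (Jb true) `|` cyl (Jb false).
    rewrite !cyl_cons -setIUl /=; apply/seteqP; split=> w /=; last by case.
    by move=> h1; split=> //; case: (Y t a w); [left|right].
  have disj : [disjoint cyl (Jb true) & cyl (Jb false)].
    apply/disj_setPS => w /=; rewrite !cyl_cons /= => -[[-> _] []//].
  have m0 : 0 <= mu a by have /andP[] := mu01 a.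
  have part c : (\int[P]_(w in cyl (Jb c)) (gain rule t h ((b, None) :: s) w)%:E =
      P (cyl (Jb c)) * (mu a + value rule s (rcons h (a, c)))%:E)%E.
    rewrite (eq_integral (fun w => (mu a)%:E +
        (gain rule t.+1 (rcons h (a, c)) s w)%:E)%E); last first.
      move=> w; rewrite inE cyl_cons /= => -[Yc _].
      by rewrite gain_residual -/a Yc EFinD.
    rewrite ge0_integralD //=.
    + rewrite integral_cst //; last exact: measurable_cyl.
      rewrite IH //; last exact: tJb.
        exact: fin_mule_distr (prob_cyl _).
    + exact: measurable_cyl.
    + by move=> w _; rewrite lee_fin gain_ge0.
    + exact: measurable_EFin_gain.
  rewrite {1}split ge0_integral_setU //.
  + rewrite !part !prob_cyl // /Jb !big_cons /= -!EFinM -EFinD; congr EFin.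
    rewrite -/a; ring.
  + exact: measurable_cyl.
  + exact: measurable_cyl.
  + exact: measurable_EFin_gain.
  + by move=> w _; rewrite lee_fin gain_ge0.
Qed.

Lemma expectation_gain B rule (s : seq ('I_B * option 'I_K)) :
  ('E_P[gain rule 0 [::] s] = (value rule s [::])%:E)%E.
Proof.
have cyl0 : cyl [::] = setT by apply/seteqP.
rewrite expectation.unlock -cyl0 integral_gain //.
by rewrite cyl0 probability_setT mul1e.
Qed.

(** The interleaving disappears here: only the number of residual rounds matters, since mandatory
    pulls leave the residual history unchanged. *)
Lemma valueE B rule (s : seq ('I_B * option 'I_K)) h :
  value rule s h = \sum_(x <- s) oapp mu 0 x.2
    + Ex mu rule (count (fun x => x.2 == None) s) (fun h' => \sum_(x <- h') mu x.1) h
    - \sum_(x <- h) mu x.1.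
Proof.
elim: s h => [|[b [i|]] s IH] h /=; first by rewrite big_nil add0r subrr.
- by rewrite big_cons /= IH !addrA.
- rewrite big_cons /= !IH -!cats1 !big_cat !big_seq1 /=; ring.
Qed.

End Law.

(** * Limit rate *)

Lemma xlnx_ge (R : realType) (x : R) : 0 < x -> - (2 * Num.sqrt x) <= x * ln x.
Proof.
move=> x0; have := kl_term_ge_hellinger (ltW x0) (ltr01 : 0 < 1 :> R).
by rewrite divr1 sqrtr1 mulr1; lra.
Qed.

(** One-sided continuity of [klr] up to the boundary. The logarithm of 1 - b + 2 d is kept whole
    because it diverges when b = 1; the other errors add up to 2 + 1 + 2 times sqrt d. *)
Lemma klr_shift_ge (R : realType) (a b d : R) :
  0 <= a -> b <= 1 -> 0 < d -> 3 * d < b - a ->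
  a * ln a + (1 - a) * ln (1 - a) - a * ln b - (1 - a) * ln (1 - b + 2 * d)
    - 5 * Num.sqrt d <= klr (a + d) (b - 2 * d).
Proof.
move=> a0 b1 d0 gap.
have e0 : 0 < Num.sqrt d by rewrite sqrtr_gt0.
have dE : d = Num.sqrt d ^+ 2 by rewrite sqr_sqrtr // ltW.
have e1 : Num.sqrt d <= 1 by rewrite -sqrtr1 ler_wsqrtr //; lra.
have de : d <= Num.sqrt d by rewrite {1}dE expr2 ler_piMl // ltW.
have dlnd := xlnx_ge d0.
rewrite /klr !xlnx_div; [|lra..].
have h1 : a * ln a - 2 * Num.sqrt d <= (a + d) * ln (a + d).
  have l1 : ln d <= ln (a + d) by rewrite ler_ln ?posrE; lra.
  have l2 : d * ln d <= d * ln (a + d) by rewrite ler_pM2l.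
  have l3 : a * ln a <= a * ln (a + d).
    move: a0; rewrite le_eqVlt => /predU1P[<-|a0]; first by rewrite !mul0r.
    by rewrite ler_pM2l // ler_ln ?posrE; lra.
  lra.
have h2 : (1 - a) * ln (1 - a) - d <= (1 - (a + d)) * ln (1 - (a + d)).
  have s0 : 0 < 1 - a by lra.
  have sd0 : 0 < 1 - (a + d) by lra.
  have l1 := @ln_leB1 R ((1 - a) / (1 - (a + d))) (divr_gt0 s0 sd0).
  rewrite ln_div ?posrE // in l1.
  have l2 : (1 - (a + d)) * (ln (1 - a) - ln (1 - (a + d))) <=
     (1 - (a + d)) * ((1 - a) / (1 - (a + d)) - 1) by rewrite ler_pM2l.
  have l3 : (1 - (a + d)) * ((1 - a) / (1 - (a + d)) - 1) = d.
    by field; rewrite gt_eqF.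
  have l4 : ln (1 - a) <= 0 by apply: ln_le0; lra.
  have l5 : d * ln (1 - a) <= 0 by rewrite pmulr_rle0.
  lra.
have h3 : (a + d) * ln (b - 2 * d) <= a * ln b.
  have l1 : ln (b - 2 * d) <= ln b by rewrite ler_ln ?posrE; lra.
  have l2 : ln b <= 0 by exact: ln_le0.
  have l3 : (a + d) * ln (b - 2 * d) <= (a + d) * ln b by apply: ler_wpM2l; lra.
  have l4 : d * ln b <= 0 by rewrite pmulr_rle0.
  lra.
have h4 : (1 - (a + d)) * ln (1 - (b - 2 * d)) <=
    (1 - a) * ln (1 - b + 2 * d) + 2 * Num.sqrt d.
  have -> : 1 - (b - 2 * d) = 1 - b + 2 * d by ring.
  have l1 : ln d <= ln (1 - b + 2 * d) by rewrite ler_ln ?posrE; lra.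
  have l2 : d * ln d <= d * ln (1 - b + 2 * d) by rewrite ler_pM2l.
  lra.
lra.
Qed.

Lemma exists_shift_klr_ge (R : realType) (a b k : R) :
  0 <= a -> a < b -> b <= 1 -> (k%:E < kl a b)%E ->
  exists d, [/\ 0 < d, a + d < b - 2 * d & k <= klr (a + d) (b - 2 * d)].
Proof.
move=> a0 ab; rewrite le_eqVlt => /predU1P[b1|b1] kk.
  pose H := a * ln a + (1 - a) * ln (1 - a).
  (* For b = 1 the target [kl] is +oo: [d] is so small that ln (2 d) <= -X, and the 5 absorbs the
     error 5 sqrt d. *)
  pose X := ((k - H + 5) / (1 - a)).
  pose d := Num.min (expR (- X) / 2) ((b - a) / 4).
  have ex0 := expR_gt0 (- X).
  have d0 : 0 < d by rewrite lt_min; apply/andP; split; lra.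
  have d1 : d <= (b - a) / 4 by rewrite ge_min lexx orbT.
  have dX : d <= expR (- X) / 2 by rewrite ge_min lexx.
  exists d; split=> //; first lra.
  apply: le_trans (klr_shift_ge a0 _ d0 _); [|lra|lra].
  have lX : ln (1 - b + 2 * d) <= - X.
    by rewrite -[leRHS]expRK ler_ln ?posrE ?expR_gt0 //; lra.
  have e1 : Num.sqrt d <= 1 by rewrite -sqrtr1 ler_wsqrtr //; lra.
  have s0 : 0 < 1 - a by lra.
  have l1 : (1 - a) * ln (1 - b + 2 * d) <= (1 - a) * - X by rewrite ler_pM2l.
  have XE : (1 - a) * - X = - (k - H + 5) by rewrite /X; field; rewrite gt_eqF.
  have lb : a * ln b = 0 by rewrite b1 ln1 mulr0.
  rewrite -/H; lra.
have b01 : 0 < b < 1 by apply/andP; split; lra.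
rewrite kl_klr // lte_fin in kk.
have t0 : 0 < 1 - b by lra.
(* With d = e^2 the total error is at most c e: 5 e from [klr_shift_ge], the rest from ln (1 - b + 2
   d). *)
pose c := 5 + 2 / (1 - b).
have c0 : 0 < c by rewrite addr_gt0 // divr_gt0.
pose e := Num.min (Num.min 1 ((b - a) / 4)) ((klr a b - k) / c).
have g0 : 0 < (klr a b - k) / c by rewrite divr_gt0 // subr_gt0.
have e0 : 0 < e by rewrite !lt_min ltr01 g0 andbT /=; lra.
have e1 : e <= 1 by rewrite !ge_min lexx.
have e2 : e <= (b - a) / 4 by rewrite !ge_min lexx orbT.
have e3 : e * c <= klr a b - k by rewrite -ler_pdivlMr // !ge_min lexx !orbT.
have d0 : 0 < e ^+ 2 by rewrite exprn_gt0.
have d1 : e ^+ 2 <= e by rewrite expr2 ler_piMl // ltW.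
exists (e ^+ 2); split=> //; first lra.
apply: le_trans (klr_shift_ge a0 (ltW b1) d0 _); last lra.
rewrite sqrtr_sqr gtr0_norm //.
have l1 : ln (1 - b + 2 * e ^+ 2) <= ln (1 - b) + 2 * e ^+ 2 / (1 - b).
  have -> : 1 - b + 2 * e ^+ 2 = (1 - b) * (1 + 2 * e ^+ 2 / (1 - b)).
    by field; rewrite gt_eqF.
  have p0 : 0 < 2 * e ^+ 2 / (1 - b) by rewrite divr_gt0 // mulr_gt0.
  rewrite lnM ?posrE //; last lra.
  by rewrite lerD2l; apply: le_ln1Dx; lra.
have l2 : 2 * e ^+ 2 / (1 - b) <= e * (2 / (1 - b)).
  rewrite mulrAC [e * _]mulrC ler_pM2l // divr_gt0 //.
have q0 : 0 <= e * (2 / (1 - b)) by rewrite mulr_ge0 ?divr_ge0 // ltW.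
have l3 : (1 - a) * ln (1 - b + 2 * e ^+ 2) <=
    (1 - a) * (ln (1 - b) + 2 * e ^+ 2 / (1 - b)) by apply: ler_wpM2l => //; lra.
have l4 : (1 - a) * (2 * e ^+ 2 / (1 - b)) <= e * (2 / (1 - b)).
  apply: le_trans l2; apply: ler_piMl; last lra.
  by rewrite divr_ge0 ?mulr_ge0 // ltW.
have kE : klr a b = a * ln a + (1 - a) * ln (1 - a) - a * ln b - (1 - a) * ln (1 - b).
  rewrite /klr !xlnx_div; [|lra..]; ring.
rewrite kE in e3 *; rewrite /c mulrDr in e3; lra.
Qed.

Lemma kl_gt0 (R : realType) (a b : R) : 0 <= a -> a < b -> b <= 1 -> (0 < kl a b)%E.
Proof.
move=> a0 ab; rewrite le_eqVlt => /predU1P[b1|b1].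
  rewrite b1 in ab *; rewrite /kl /kl_term subrr eqxx oner_eq0.
  have -> : (1 - a == 0) = false by apply/eqP; lra.
  by case: ifP => _; rewrite ?add0e ?addey // ltry.
have b01 : 0 < b < 1 by apply/andP; split; lra.
rewrite kl_klr // lte_fin; apply: lt_le_trans (klr_ge_sqr _ b01); last lra.
by rewrite divr_gt0 // exprn_even_gt0 //= subr_eq0 lt_eqF.
Qed.

(* If b = 1 then kl a b = +oo and the quotient on the right is 0. *)
Lemma exists_shift_rate (R : realType) (a b eps : R) :
  0 <= a -> a < b -> b <= 1 -> 0 < eps ->
  exists d, [/\ 0 < d, a + d < b - 2 * d &
   ((((b - a) / klr (a + d) (b - 2 * d))%:E) <= (b - a)%:E / kl a b + eps%:E)%E].
Proof.
move=> a0 ab b1 eps0; have k0 := kl_gt0 a0 ab b1.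
have pos d : 0 < d -> a + d < b - 2 * d -> 0 < klr (a + d) (b - 2 * d).
  move=> d0 gap; have q : 0 < b - 2 * d < 1 by apply/andP; split; lra.
  apply: lt_le_trans (klr_ge_sqr _ q); last lra.
  by rewrite divr_gt0 // exprn_even_gt0 //= subr_eq0 lt_eqF.
have ba : 0 < b - a by lra.
case E: (kl a b) k0 => [k| |] // k0.
  rewrite lte_fin in k0.
  have r0 : 0 < (b - a) / k + eps by rewrite addr_gt0 // divr_gt0.
  have [|d [d0 gap kd]] := @exists_shift_klr_ge _ a b ((b - a) / ((b - a) / k + eps)) a0 ab b1.
    rewrite E lte_fin ltr_pdivrMr // mulrDr.
    have -> : k * ((b - a) / k) = b - a by field; rewrite gt_eqF.
    by rewrite ltrDl mulr_gt0.
  exists d; split=> //; rewrite inver gt_eqF // -EFinM -EFinD lee_fin.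
  by rewrite ler_pdivrMr ?pos // mulrC -ler_pdivrMr.
have [|d [d0 gap kd]] := @exists_shift_klr_ge _ a b ((b - a) / eps) a0 ab b1.
  by rewrite E ltry.
exists d; split=> //; rewrite invey mule0 add0e lee_fin.
by rewrite ler_pdivrMr ?pos // mulrC -ler_pdivrMr.
Qed.

Lemma eventually_log_dominated (R : realType) (A B eta : R) : 0 <= B -> 0 < eta ->
  exists L0, forall L, L0 <= L -> 0 <= L ->
    A + B * (L + ln (L ^+ 2 + 1)) <= (B + eta) * L.
Proof.
move=> B0 eta0; exists (2 * (A + eta / 2 + 8 * B ^+ 2 / eta) / eta) => L L0 Lpos.
set s := Num.sqrt (1 + L).
have s0 : 0 < s by rewrite sqrtr_gt0; lra.
have sE : s ^+ 2 = 1 + L by rewrite sqr_sqrtr; lra.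
have h1 : ln (L ^+ 2 + 1) <= 4 * s.
  have : ln (L ^+ 2 + 1) <= ln ((s ^+ 2) ^+ 2).
    rewrite sE ler_ln ?posrE ?exprn_gt0 //; [|by rewrite ltr_wpDl ?sqr_ge0|lra].
    by nra.
  rewrite -exprM lnXn // -[_ *+ _]mulr_natl.
  by have := ln_leB1 s0; lra.
have h2 : B * ln (L ^+ 2 + 1) <= B * (4 * s) by rewrite ler_wpM2l.
have h3 : B * (4 * s) <= eta / 2 * s ^+ 2 + 8 * B ^+ 2 / eta.
  rewrite -subr_ge0.
  have -> : eta / 2 * s ^+ 2 + 8 * B ^+ 2 / eta - B * (4 * s)
      = (eta * s - 4 * B) ^+ 2 / (2 * eta) by field; rewrite gt_eqF.
  by rewrite divr_ge0 ?sqr_ge0 // mulr_ge0 // ltW.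
rewrite sE in h3; move: L0; rewrite ler_pdivrMr // => L0.
lra.
Qed.

Lemma limn_esup_le (R : realType) (u : (\bar R)^nat) (c : \bar R) :
  (\forall n \near \oo, (u n <= c)%E) -> (limn_esup u <= c)%E.
Proof.
move=> uc; apply: (@le_trans _ _ (ereal_sup (u @` [set n | (u n <= c)%E]))).
  by apply: ereal_inf_lbound; exists [set n | (u n <= c)%E].
by apply: ge_ereal_sup => _ [n un <-].
Qed.

Lemma sum_count_mem (R : pzRingType) (T : finType) (s : seq T) (f : T -> R) :
  \sum_(x <- s) f x = \sum_(x : T) (count_mem x s)%:R * f x.
Proof.
elim: s => [|y s IH]; first by rewrite big_nil big1 // => x _; rewrite mul0r.
rewrite big_cons IH (bigD1 y) //= [in RHS](bigD1 y) //= eqxx natrD mulrDl mul1r addrA.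
by congr (_ + _); apply: eq_bigr => x xy; rewrite eq_sym (negbTE xy).
Qed.

Lemma sum_flatten (R : pzRingType) (T : Type) (ss : seq (seq T)) (f : T -> R) :
  \sum_(x <- flatten ss) f x = \sum_(s <- ss) \sum_(x <- s) f x.
Proof.
by elim: ss => [|s ss IH] /=; rewrite ?big_nil // big_cat big_cons IH.
Qed.

Lemma count_play B K rule y t h (s : seq ('I_B * option 'I_K)) b i :
  (count_mem (b, Some i) s <= count_mem (b, i) (play rule y t h s))%N.
Proof.
elim: s t h => [|[b' [j|]] s IH] t h //=; last first.
  rewrite !xpair_eqE andbF add0n; apply: leq_trans (IH t.+1 _) _.
  exact: leq_addl.
by rewrite !xpair_eqE (inj_eq Some_inj) leq_add2l.
Qed.

(** * From the algorithm to the decision tree, and the limit *)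

Section Algorithm.
Context (R : realType) (K : nat) (m : floors K) (alg : bdq_kl R m).

Lemma count_rounds (p : pred ('I_(nblocks m) * option 'I_K)) :
  count p (rounds alg) = (\sum_(b < nblocks m)
    (count (fun i => p (b, Some i)) (mandatory alg b)
     + p (b, None) * (blen b - \sum_(i < K) mfloor b i)))%N.
Proof.
rewrite /rounds count_flatten -map_comp sumnE big_map big_enum /=.
apply: eq_bigr => b _; rewrite count_map count_cat count_map count_nseq.
by [].
Qed.

Lemma block_pulls_ge y b i : (mfloor b i <= block_pulls alg y b i)%N.
Proof.
apply: leq_trans (count_play _ _ _ _ _ _ _).
rewrite count_rounds (bigD1 b) //= (leq_trans _ (leq_addr _ _)) //.
rewrite (leq_trans _ (leq_addr _ _)) // -(mandatory_count alg b i).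
by rewrite (eq_count (a2 := pred1 i)) // => j /=; rewrite xpair_eqE eqxx (inj_eq Some_inj).
Qed.

Lemma residual_rounds : count (fun x => x.2 == None) (rounds alg) = residual m.
Proof.
rewrite count_rounds /residual; apply: eq_bigr => b _ /=.
by rewrite mul1n (eq_count (a2 := pred0)) // count_pred0 add0n.
Qed.

Lemma mandatory_rounds (mu : 'I_K -> R) :
  \sum_(x <- rounds alg) oapp mu 0 x.2 =
    \sum_(b < nblocks m) \sum_(i < K) (mfloor b i)%:R * mu i.
Proof.
rewrite /rounds sum_flatten big_map big_enum /=; apply: eq_bigr => b _.
rewrite big_map big_cat /= big_map /= [X in _ + X]big1_seq ?addr0; last first.
  by move=> x /andP[_]; rewrite mem_nseq => /andP[_ /eqP ->].
rewrite sum_count_mem; apply: eq_bigr => i _.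
by rewrite mandatory_count.
Qed.

Lemma horizonE : horizon m = (residual m + \sum_(b < nblocks m) \sum_(i < K) mfloor b i)%N.
Proof.
rewrite /horizon /residual -big_split /=; apply: eq_bigr => b _.
by rewrite subnK // mfloor_le.
Qed.

Section Instance.
Context (mu : 'I_K -> R) (istar : 'I_K).
Context d (Omega : measurableType d) (P : probability Omega R).
Context (Y : nat -> 'I_K -> {RV P >-> bool}).
Context (mu01 : forall i, 0 <= mu i <= 1) (mu_istar : mu istar = mustar mu).
Context (Yb : bernoulli_rewards mu Y).
Notation T := (residual m).

Lemma RegE : Reg mu istar Y alg =
  (Ex mu (rule alg) T (fun h => \sum_(x <- h) Delta mu x.1) [::])%:E.
Proof.
rewrite /Reg.
have -> : ('E_P[(fun w => \sum_(ba <- trajectory alg (fun t i => Y t i w)) mu ba.2)%R] =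
    (value mu (rule alg) (rounds alg) [::])%:E)%E := expectation_gain mu01 Yb _ _.
rewrite -EFinB; congr EFin.
rewrite valueE big_nil subr0 residual_rounds mandatory_rounds /OPT horizonE.
set D := Ex _ _ _ _ _.
have -> : Ex mu (rule alg) T (fun h => \sum_(x <- h) Delta mu x.1) [::] =
    T%:R * mustar mu - D.
  have E h : consistent (rule alg) h -> size h = (0 + T)%N ->
      \sum_(x <- h) Delta mu x.1 = T%:R * mustar mu + (-1) * \sum_(x <- h) mu x.1.
    move=> _; rewrite add0n => hT.
    by rewrite sumrB big_const_seq count_predT hT iter_addr_0 -[_ *+ T]mulr_natl mulN1r.
  have cn := @consistent_nil _ (rule alg).
  have -> : Ex mu (rule alg) T (fun h => \sum_(x <- h) Delta mu x.1) [::] =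
      Ex mu (rule alg) T (fun h => T%:R * mustar mu + (-1) * \sum_(x <- h) mu x.1) [::].
    by apply/eqP; rewrite eq_le; apply/andP; split; apply: Ex_le => // h ch hT;
      rewrite E.
  by rewrite ExD Ex_cst ExZ mulN1r.
(* The excluded arm may be restored because its gap is zero. *)
have -> : \sum_(b < nblocks m) \sum_(i < K | i != istar) (mfloor b i)%:R * Delta mu i
    = \sum_(b < nblocks m) (\sum_(i < K) (mfloor b i)%:R * mustar mu
      - \sum_(i < K) (mfloor b i)%:R * mu i).
  apply: eq_bigr => b _; rewrite -sumrB [RHS](bigD1 istar) //= mu_istar subrr add0r.
  by apply: eq_bigr => i _; rewrite /Delta mulrBr.
have hE : (\sum_(b < nblocks m) \sum_(i < K) mfloor b i)%N%:R * mustar mu =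
    \sum_(b < nblocks m) \sum_(i < K) (mfloor b i)%:R * mustar mu :> R.
  rewrite natr_sum mulr_suml; apply: eq_bigr => b _.
  by rewrite natr_sum mulr_suml.
rewrite sumrB natrD mulrDl hE; ring.
Qed.

Lemma Reg_minimax :
  (Reg mu istar Y alg <= (1634 * Num.sqrt (K%:R * T%:R) + K%:R)%:E)%E.
Proof.
by rewrite RegE lee_fin; exact: (Ex_regret_minimax mu01 mu_istar (rule_klucbpp alg)).
Qed.

Lemma regret_by_arm : Ex mu (rule alg) T (fun h => \sum_(x <- h) Delta mu x.1) [::] =
  \sum_(i < K) Delta mu i * Ex mu (rule alg) T (fun h => (size (rewards h i))%:R) [::].
Proof.
have E h : \sum_(x <- h) Delta mu x.1 = \sum_(i < K) Delta mu i * (size (rewards h i))%:R.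
  rewrite -(big_map (fun x => x.1) xpredT (Delta mu)) sum_count_mem.
  by apply: eq_bigr => i _; rewrite mulrC count_map size_rewards.
rewrite (_ : (fun h => _) = (fun h => \sum_(i < K) Delta mu i * (size (rewards h i))%:R)).
  by rewrite Ex_sum; apply: eq_bigr => i _; rewrite ExZ.
by apply/funext => h; exact: E.
Qed.

End Instance.
End Algorithm.

(** Half of [eps] goes to the shift [d] in the divergence, half to the lower-order terms. Once [d]
    is fixed these depend on the floors only through ln R, so [L0] serves all floors and
    algorithms. *)
Lemma arm_rate (R : realType) (K : nat) (mu : 'I_K -> R) (istar i : 'I_K) (eps : R) :
  (forall i, 0 <= mu i <= 1) -> mu istar = mustar mu -> 0 < eps ->
  exists L0 : R, forall (m : floors K) (alg : bdq_kl R m), 1 <= ln ((residual m)%:R : R) ->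
    L0 <= ln ((residual m)%:R : R) ->
   ((Delta mu i * Ex mu (rule alg) (residual m) (fun h => (size (rewards h i))%:R) [::]
     / ln (residual m)%:R)%:E <=
     (if (Delta mu i == 0)%R then 0 else (Delta mu i)%:E / kl (mu i) (mustar mu))
       + eps%:E)%E.
Proof.
move=> mu01 mu_istar eps0; have D0 := Delta_ge0 mu i.
have [DE|Dn0] := eqVneq (Delta mu i) 0.
  by exists 0 => m alg _ _; rewrite DE !mul0r add0e lee_fin ltW.
have Dpos : 0 < Delta mu i by rewrite lt_neqAle eq_sym Dn0.
have /andP[a0 _] := mu01 i; have /andP[_ b1] := mu01 istar; rewrite mu_istar in b1.
have ab : mu i < mustar mu by rewrite -subr_gt0.
have e20 : 0 < eps / 2 by rewrite divr_gt0.
have [d [d0 gap rate]] := exists_shift_rate a0 ab b1 e20.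
set kd := klr _ _ in rate.
have kd0 : 0 < kd.
  have q : 0 < mustar mu - 2 * d < 1 by apply/andP; split; lra.
  apply: lt_le_trans (klr_ge_sqr _ q); last lra.
  by rewrite divr_gt0 // exprn_even_gt0 //= subr_eq0 lt_eqF.
pose A := Delta mu i * (1 + (800 * K%:R + 8) / d ^+ 2).
have B0 : 0 <= Delta mu i / kd by rewrite divr_ge0 // ltW.
have [L0 HL] := eventually_log_dominated A B0 e20.
exists L0 => m alg L1 LL.
set T := residual m in L1 LL *; set L := ln T%:R in L1 LL *.
have T0 : (0 < T)%N.
  rewrite lt0n; apply/eqP => T0; move: L1; rewrite /L T0 ln0 //; lra.
have T1 : 1 <= T%:R :> R by rewrite ler1n.
have md0 : 0 < mu i + d by lra.
have bound := Ex_pulls_le mu01 mu_istar (rule_klucbpp alg) d0 T0 md0 gap.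
rewrite -/T -/kd explorE // -/L in bound.
set N := Ex _ _ _ _ _ in bound *.
have L0pos : 0 < L by lra.
have h : Delta mu i * N <= (Delta mu i / kd + eps / 2) * L.
  have hL := HL _ LL (ltW L0pos).
  apply: le_trans hL; apply: (@le_trans _ _ (Delta mu i * (1 +
      (L + ln (L ^+ 2 + 1)) / kd + (800 * K%:R + 8) / d ^+ 2))).
    by rewrite ler_pM2l.
  by rewrite /A le_eqVlt; apply/orP; left; apply/eqP; field; rewrite !gt_eqF.
rewrite -ler_pdivrMr // in h.
have h' : ((Delta mu i * N / L)%:E <= (Delta mu i / kd)%:E + (eps / 2)%:E)%E.
  by rewrite -EFinD lee_fin.
apply: le_trans h' _.
apply: (@le_trans _ _ ((Delta mu i)%:E / kl (mu i) (mustar mu) + (eps / 2)%:E + (eps / 2)%:E)%E).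
  by apply: leeD.
by rewrite -addeA -EFinD -splitr.
Qed.

Lemma limn_esup_regret (R : realType) (K : nat) (mu : 'I_K -> R) (istar : 'I_K)
    (d : measure_display) (Omega : measurableType d) (P : probability Omega R)
    (Y : nat -> 'I_K -> {RV P >-> bool}) (m : nat -> floors K)
    (alg : forall n, bdq_kl R (m n)) :
  (forall i, 0 <= mu i <= 1) -> mu istar = mustar mu -> bernoulli_rewards mu Y ->
  (residual (m n) @[n --> \oo] --> \oo) ->
  (limn_esup (fun n => Reg mu istar Y (alg n) / (ln ((residual (m n))%:R : R))%:E)
    <= \sum_(i < K | i != istar)
         (if (Delta mu i == 0)%R then 0 else (Delta mu i)%:E / kl (mu i) (mustar mu)))%E.
Proof.
move=> mu01 mu_istar Yb mT.
have KR0 : 0 < K%:R :> R by rewrite ltr0n; apply: leq_ltn_trans (ltn_ord istar).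
apply/lee_addgt0Pr => eps eps0; apply: limn_esup_le.
have e0 : 0 < eps / K%:R by rewrite divr_gt0.
have [L0 HL0] := choice (fun i => arm_rate i mu01 mu_istar e0).
(* The base value 1 also gives 1 <= ln R, which makes the quotient by ln R genuine. *)
pose L1 := \big[Num.max/1]_(i < K) L0 i.
have [N HN] : exists N : nat, forall T, (N <= T)%N -> L1 <= ln (T%:R : R).
  have := archi_boundP (expR_ge0 L1); set N := Num.bound _ => hN.
  exists N => T NT; rewrite -[leLHS]expRK ler_ln ?posrE ?expR_gt0 //.
    by rewrite (le_trans (ltW hN)) // ler_nat.
  by rewrite (lt_le_trans (expR_gt0 L1)) // (le_trans (ltW hN)) // ler_nat.
have nN : \forall n \near \oo, (N <= residual (m n))%N.
  by move/cvgnyPge: mT => /(_ N).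
near=> n; have TN : (N <= residual (m n))%N by near: n.
have LT := HN _ TN.
have L1le i : L0 i <= ln ((residual (m n))%:R : R).
  by apply: le_trans LT; rewrite /L1; apply: le_bigmax.
have L11 : 1 <= ln ((residual (m n))%:R : R).
  by apply: le_trans LT; rewrite /L1; apply: bigmax_ge_id.
rewrite (RegE _ mu01 mu_istar Yb) regret_by_arm inver gt_eqF; last by lra.
rewrite -EFinM mulr_suml (bigD1 istar) //=.
have -> : Delta mu istar = 0 by rewrite /Delta mu_istar subrr.
rewrite !mul0r add0r -sumEFin.
apply: (@le_trans _ _ (\sum_(i < K | i != istar)
   ((if (Delta mu i == 0)%R then 0 else (Delta mu i)%:E / kl (mu i) (mustar mu))
     + (eps / K%:R)%:E))%E).
  by apply: lee_sum => i _; apply: HL0.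
rewrite big_split /= leeD2l // sumEFin lee_fin.
apply: (@le_trans _ _ (\sum_(i < K) eps / K%:R)).
  by rewrite [leRHS](bigD1 istar) //= lerDr ltW.
by rewrite sumr_const card_ord -[_ *+ K]mulr_natl mulrC divfK ?gt_eqF.
Unshelve. all: by end_near.
Qed.

Theorem corollary20 (R : realType) :
  exists C : R,
  forall (K : nat) (mu : 'I_K -> R) (istar : 'I_K)
         (d : measure_display) (Omega : measurableType d)
         (P : probability Omega R) (Y : nat -> 'I_K -> {RV P >-> bool}),
    (forall i, 0 <= mu i <= 1) ->
    mu istar = mustar mu ->
    bernoulli_rewards mu Y ->
    (forall (m : floors K) (alg : bdq_kl R m),
       (forall (w : Omega) (b : 'I_(nblocks m)) (i : 'I_K),
          (mfloor b i <= block_pulls alg (fun t j => Y t j w) b i)%N) /\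
       (Reg mu istar Y alg
          <= (C * Num.sqrt (K%:R * (residual m)%:R) + K%:R)%:E)%E) /\
    (forall (m : nat -> floors K) (alg : forall n, bdq_kl R (m n)),
       (residual (m n) @[n --> \oo] --> \oo) ->
       (limn_esup (fun n =>
            Reg mu istar Y (alg n) / (ln ((residual (m n))%:R : R))%:E)
        <= \sum_(i < K | i != istar)
             (if (Delta mu i == 0)%R then 0
              else (Delta mu i)%:E / kl (mu i) (mustar mu)))%E).
Proof.
exists 1634 => K mu istar d Omega P Y mu01 mu_istar Yb; split=> [m alg|m alg mT].
  split; last exact: Reg_minimax.
  by move=> w b i; exact: block_pulls_ge.
exact: limn_esup_regret.
Qed.
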